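(* Let $X$ be a Banach space with a finite dimensional decomposition $(X_n)_{n\in\mathbb N}$, let $a,b>0$, and let $S\subset X$ be an $(a,b)$-spiderweb grid with respect to $(X_n)$. Then $S$, with the metric induced by the norm of $X$, has a retractional basis.
   Context: $\mathbb N=\{1,2,\dots\}$. Banach spaces are real; $S_Y$ denotes the unit sphere of a Banach space $Y$. A finite dimensional decomposition (FDD) of $X$ is a sequence $(X_n)$ of (nonzero) finite dimensional subspaces such that every $x\in X$ has a unique representation $x=\sum_{n} x_n$ (norm convergent) with $x_n\in X_n$. A subset $N$ of a metric space $(M,d)$ is an $(a,b)$-net of $M$ if $d(x,y)\ge a$ for all distinct $x,y\in N$ and for every $x\in M$ there is $y\in N$ with $d(x,y)\le b$. Let $Y$ be a finite dimensional Banach space. A set $N\subset Y$ is a base of an $(a,b)$-spiderweb of $Y$ if $N=\bigcup_{n=0}^\infty S_n$ for some nonempty sets $S_n\subset nS_Y$ ($n\ge 0$; so $S_0=\{0\}$) such that $2S_{2^n}\subset S_{2^{n+1}}$ for all $n\ge0$; $S_n$ is an $(a,b)$-net of $nS_Y$ for all $n\in\mathbb N$; and $S_m=\frac{m}{2^n}S_{2^n}$ for all $n\in\mathbb N$ and $m\in\{2^n+1,\dots,2^{n+1}-1\}$. An $(a,b)$-spiderweb grid with respect to the FDD $(X_n)$ is a set of the form $S=\bigcup_{n\in\mathbb N}\sum_{m=1}^n S^m$ (Minkowski sums), where for each $m\in\mathbb N$, $S^m$ is a base of an $(a,b)$-spiderweb of $X_m$. Let $M$ be a countable metric space and $K\ge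 1$. A $K$-retractional basis of $M$ is a sequence of retractions $\varphi_n:M\to M$, $n\in\mathbb N$, for which there are points $x_1,x_2,\dots\in M$ such that: (1) $\varphi_n(M)=\{x_1,\dots,x_n\}$ for every $n$ (and $\varphi_n$ restricts to the identity on this set); (2) $\bigcup_{j\ge1}\{x_j\}=M$; (3) every $\varphi_n$ is $K$-Lipschitz; (4) $\varphi_m\circ\varphi_n=\varphi_{\min(m,n)}$ for all $m,n$. $M$ has a retractional basis if it has a $K$-retractional basis for some $K\ge1$. *)

(* Defs.v *)
From HB Require Import structures.
From mathcomp Require Import all_boot all_order all_algebra.
From mathcomp Require Import all_classical all_reals all_analysis.

Set Implicit Arguments.
Unset Strict Implicit.
Unset Printing Implicit Defensive.

Import Order.TTheory GRing.Theory Num.Theory.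
Import numFieldNormedType.Exports.

Local Open Scope classical_set_scope.
Local Open Scope ring_scope.

(* Indexing: the sequences (X_n), (S^m), (phi_n), (x_n), which the mathematics
   indexes from 1, are indexed from 0 below (term k stands for term k + 1).
   The layers S_n of a spiderweb, indexed from 0, keep their index. *)

(* The metric space A, with the metric induced by the norm of V. *)
Definition metric_subspace (R : realType) (V : normedModType R) (A : set V)
  : Type := set_type A.

Section MetricSubspace.
Context (R : realType) (V : normedModType R) (A : set V).

HB.instance Definition _ := Choice.copy (metric_subspace A) (set_type A).

Definition subdist (x y : metric_subspace A) : R := `|set_val x - set_val y|.

Lemma subdistxx x : subdist x x = 0.
Proof. by rewrite /subdist subrr normr0. Qed.

Lemma subdist_positivity x y : subdist x y = 0 -> x = y.
Proof. by move=> /normr0_eq0/subr0_eq/val_inj. Qed.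

Lemma subdist_sym x y : subdist x y = subdist y x.
Proof. exact: distrC. Qed.

Lemma subdist_triangle y x z : subdist x z <= subdist x y + subdist y z.
Proof. exact: ler_distD. Qed.

HB.instance Definition _ := isMetric.Build R (metric_subspace A)
  subdistxx subdist_positivity subdist_sym subdist_triangle.

End MetricSubspace.

Definition is_net (R : realType) (M : metricType R) (a b : R) (N : set M) :=
  (forall x y, N x -> N y -> x <> y -> a <= mdist x y) /\
  (forall x, exists2 y, N y & mdist x y <= b).

(* Countability of M is a consequence of the second clause. *)
Definition retractional_basis (R : realType) (M : metricType R) (K : R)
    (phi : nat -> M -> M) :=
  exists x : nat -> M,
    [/\ forall n, range (phi n) = [set x i | i in [set i | (i <= n)%N]] /\
          (forall i, (i <= n)%N -> phi n (x i) = x i),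
        range x = [set: M],
        forall n y z, mdist (phi n y) (phi n z) <= K * mdist y z
      & forall m n, phi m \o phi n = phi (minn m n)].

Definition has_retractional_basis (R : realType) (M : metricType R) :=
  exists2 K : R, 1 <= K &
    exists phi : nat -> M -> M, retractional_basis K phi.

Section Spiderweb.
Context (R : realType) (V : normedModType R).

Definition finite_dim_subspace (Y : set V) :=
  exists (d : nat) (e : 'I_d -> V),
    Y = [set \sum_i c i *: e i | c in [set: 'I_d -> R]].

Definition is_FDD (Xs : nat -> set V) :=
  (forall n, finite_dim_subspace (Xs n) /\ exists2 x, Xs n x & x != 0) /\
  (forall x : V, exists! u : nat -> V,
     (forall n, Xs n (u n)) /\ series u @ \oo --> x).

Definition unit_sphere (Y : set V) : set V := [set y | Y y /\ `|y| = 1].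

Definition scale_set (t : R) (A : set V) : set V := [set t *: y | y in A].

Definition minkowski_add (A B : set V) : set V :=
  [set x + y | x in A & y in B].

Definition spiderweb_base (a b : R) (Y N : set V) :=
  exists S : nat -> set V,
    N = \bigcup_n S n /\
    [/\ forall n, S n !=set0 /\ S n `<=` scale_set n%:R (unit_sphere Y),
        forall n, scale_set 2 (S (2 ^ n)%N) `<=` S (2 ^ n.+1)%N,
        forall n, (1 <= n)%N ->
          is_net (M := metric_subspace (scale_set n%:R (unit_sphere Y)))
            a b (set_val @^-1` S n)
      & forall n m, (1 <= n)%N -> (2 ^ n < m < 2 ^ n.+1)%N ->
          S m = scale_set (m%:R / (2 ^ n)%:R) (S (2 ^ n)%N)].

Definition spiderweb_grid (a b : R) (Xs : nat -> set V) (S : set V) :=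
  exists B : nat -> set V,
    (forall m, spiderweb_base a b (Xs m) (B m)) /\
    S = \bigcup_n \big[minkowski_add/[set 0]]_(m < n.+1) B m.

End Spiderweb.

(* Main.v *)
(** The weight of a grid point [x = \sum_i x_i], with [x_i] in the [i]-th
    spiderweb, is the integer [\sum_i 2^i |x_i|]; only finitely many points
    have weight at most [N]. The points form a tree rooted at [0]: the parent
    of [x] is obtained by moving its last nonzero coordinate one layer inwards
    in its spiderweb, towards an approximately radial predecessor, which lowers
    the weight. Enumerate the grid by increasing weight and let [phi_n] send a
    point to its first ancestor among the first [n] points: these retractions
    commute for formal reasons.

    Each [phi_n x] is within a bounded distance of the first ancestor of [x]
    of weight at most some [N]. That ancestor keeps the coordinates
    [x_0, ..., x_(j-1)], clips [x_j] to the radius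
    [(N - \sum_(i < j) 2^i |x_i|) / 2^j] and kills the later ones, where [j] is
    the first index at which the partial weight exceeds [N]. Since the partial
    sums of the decomposition are uniformly bounded (Baire) and the weights
    grow geometrically, the clipping radius is Lipschitz in [x] with a constant
    independent of [j], and so is the whole map up to a bounded error. The grid
    is uniformly discrete, so the bounded error is absorbed by the Lipschitz
    constant. *)

Require Import Defs.
From mathcomp Require Import all_boot all_order all_algebra.
From mathcomp Require Import all_classical all_reals all_analysis.
From mathcomp Require Import zify ring lra.

Set Implicit Arguments.
Unset Strict Implicit.
Unset Printing Implicit Defensive.

Import Order.TTheory GRing.Theory Num.Theory.
Import numFieldNormedType.Exports.

Local Open Scope classical_set_scope.
Local Open Scope ring_scope.

(** * Trees and retractional bases *)

Section Ancestors.
Context (M : Type) (p : M -> M).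

(** The default [0] makes [anc A y] equal to [y] when the orbit of [y] misses [A]. *)
Definition first_hit (A : set M) (y : M) : nat :=
  if pselect (exists k, `[< A (iter k p y) >]) is left h then ex_minn h else 0%N.

Definition anc (A : set M) (y : M) : M := iter (first_hit A y) p y.

Lemma ancP A y : (exists k, A (iter k p y)) ->
  A (anc A y) /\ forall i, (i < first_hit A y)%N -> ~ A (iter i p y).
Proof.
move=> [k Ak]; rewrite /anc /first_hit; case: pselect => [h|[]]; last first.
  by exists k; apply/asboolP.
case: ex_minnP => m /asboolP Am min_m; split=> // i i_lt_m Ai.
by move: i_lt_m; rewrite ltnNge min_m //; apply/asboolP.
Qed.

Lemma anc_first A y k : A (iter k p y) ->
  (forall i, (i < k)%N -> ~ A (iter i p y)) -> anc A y = iter k p y.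
Proof.
move=> Ak min_k; have [Am min_m] : _ /\ _ := ancP (ex_intro _ k Ak).
rewrite /anc; congr (iter _ p y); apply/eqP; rewrite eqn_leq; apply/andP; split.
  by rewrite leqNgt; apply/negP => /min_m.
by rewrite leqNgt; apply/negP => /min_k.
Qed.

Lemma anc_id A y : A y -> anc A y = y.
Proof. by move=> Ay; apply: (@anc_first _ _ 0). Qed.

(** Since [A] is contained in [B], the orbit of [y] meets [B] no later than [A], so walking on from
    the stop in [B] reaches the same point of [A]. This makes the retractions commute. *)
Lemma anc_anc A B y : A `<=` B -> (exists k, A (iter k p y)) ->
  anc A (anc B y) = anc A y.
Proof.
move=> AB exA; have [Aa min_a] := ancP exA.
have exB : exists k, B (iter k p y) by case: exA => k /AB; exists k.
have [_ min_b] := ancP exB.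
have le_ba : (first_hit B y <= first_hit A y)%N.
  rewrite leqNgt; apply/negP => /min_b; apply; exact: AB.
have iterB i : iter i p (anc B y) = iter (i + first_hit B y) p y.
  by rewrite /anc iterD.
have aE : anc A y = iter (first_hit A y - first_hit B y) p (anc B y).
  by rewrite iterB subnK.
rewrite aE; apply: anc_first => [|i i_lt]; first by rewrite -aE.
by rewrite iterB; apply: min_a; rewrite -ltn_subRL; lia.
Qed.

End Ancestors.

(** * Enumeration of the points by increasing weight *)

Section RankedEnumeration.
Context (M : choiceType) (W : M -> nat).
Hypothesis W_finite : forall N, finite_set [set x | (W x <= N)%N].

(** Take [z] of least weight outside [s]. The second clause covers the case where [s] exhausts the
    type, in which any point serves. *)
Lemma next_point (o : M) (s : seq M) :
  exists z, (forall z', (W z' < W z)%N -> z' \in s) /\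
            (z \in s -> forall z', z' \in s).
Proof.
have [all_s|/existsNP[z0 /negP z0s]] := pselect (forall z, z \in s).
  by exists o.
have ex_new : exists k, `[< exists2 z, z \notin s & W z = k >].
  by exists (W z0); apply/asboolP; exists z0.
case: (ex_minnP ex_new) => k /asboolP[z zs Wz] min_k.
exists z; split; last by rewrite (negbTE zs).
move=> z' lt_z'; apply/negPn/negP => z's; move: lt_z'; rewrite Wz ltnNge min_k //.
by apply/asboolP; exists z'.
Qed.

Lemma ranked_enumeration (o : M) : exists e : nat -> M,
  (forall n z, (W z < W (e n))%N -> exists2 i, (i < n)%N & z = e i) /\
  (forall z, exists n, e n = z).
Proof.
have [nxt nxtP] := choice (next_point o).
pose L := fix L n : seq M := if n is n'.+1 then rcons (L n') (nxt (L n')) else [::].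
pose e n := nxt (L n).
have LP n z : z \in L n -> exists2 i, (i < n)%N & z = e i.
  elim: n => [//|n IH] /=; rewrite mem_rcons inE => /orP[/eqP ->|/IH[i i_n ->]].
    by exists n.
  by exists i => //; apply: ltnW.
exists e; split=> [n z lt_z|z]; first exact/LP/((nxtP _).1 _ lt_z).
(* If [z] were never listed, every [e n] would be a new point of weight at most [W z], against the
   finiteness of that set. *)
apply: contrapT => z_new.
have zL n : z \notin L n.
  by apply/negP => /LP[i _ zE]; apply: z_new; exists i.
have eL n : e n \notin L n.
  by apply/negP => /((nxtP (L n)).2)/(_ z); rewrite (negbTE (zL n)).
have We n : (W (e n) <= W z)%N.
  by rewrite leqNgt; apply/negP => /((nxtP (L n)).1); rewrite (negbTE (zL n)).
have uL n : uniq (L n) /\ size (L n) = n.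
  by elim: n => [//|n [uLn sLn]] /=; rewrite rcons_uniq size_rcons eL uLn sLn.
have /finite_seqP[s sE] := W_finite (W z).
have : (size (L (size s).+1) <= size s)%N.
  apply: uniq_leq_size; first by case: (uL (size s).+1).
  move=> x /LP[i _ ->]; have : [set x | (W x <= W z)%N] (e i) by exact: We.
  by rewrite sE.
by rewrite (uL _).2 ltnn.
Qed.

End RankedEnumeration.

(** * Retractions of a weighted tree and their Lipschitz bound *)

Section RetractionalBasisOfTree.
Context (R : realType) (M : metricType R) (p : M -> M) (W : M -> nat) (o : M).
Context (c C1 C2 C3 : R).
Hypothesis W_finite : forall N, finite_set [set x | (W x <= N)%N].
Hypothesis W_root : W o = 0%N.
Hypothesis W_parent : forall x, x <> o -> (W (p x) < W x)%N.
Hypothesis c_gt0 : 0 < c.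
Hypothesis C1_ge0 : 0 <= C1.
Hypothesis separated : forall x y : M, x <> y -> c <= mdist x y.
Hypothesis dist_parent : forall x : M, x <> o -> mdist x (p x) <= C3.
Hypothesis dist_anc : forall N x y,
  mdist (anc p [set x | (W x <= N)%N] x) (anc p [set x | (W x <= N)%N] y)
    <= C1 * mdist x y + C2.

Lemma reaches_root (A : set M) x : A o -> exists k, A (iter k p x).
Proof.
move=> Ao; have [n] := ubnP (W x); elim: n x => // n IH x.
rewrite ltnS => Wx; have [->|/W_parent lt_px] := pselect (x = o).
  by exists 0%N.
have [|k Ak] := IH (p x); first exact: leq_trans Wx.
by exists k.+1; rewrite iterSr.
Qed.

(** The first ancestor [u] of weight at most [N] either lies in [A] or has a parent of weight below
    [N], which does: the two ancestors are at most one parent step apart. *)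
Lemma anc_prefix (A : set M) N x : A o -> A `<=` [set x | (W x <= N)%N] ->
  [set x | (W x < N)%N] `<=` A ->
  mdist (anc p A x) (anc p [set x | (W x <= N)%N] x) <= `|C3|.
Proof.
move=> Ao AN NA; set B := [set x | _] in AN *.
have Bo : B o by rewrite /B /= W_root.
rewrite -(anc_anc AN (reaches_root x Ao)).
have [Bu _] := ancP (reaches_root x Bo); set u := anc p B x in Bu *.
have [Au|Au] := pselect (A u); first by rewrite anc_id // mdistxx.
have uo : u <> o by move=> uo; rewrite uo in Au.
rewrite (@anc_first _ _ _ _ 1) /=; first 1 last.
- by apply: NA => /=; apply: leq_trans (W_parent uo) Bu.
- by case.
by rewrite metric_sym; apply: le_trans (dist_parent uo) (ler_norm _).
Qed.

Theorem retractional_basis_of_tree : has_retractional_basis M.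
Proof.
have [e [e_min e_surj]] := ranked_enumeration W_finite o.
pose A n : set M := [set e i | i in [set i | (i <= n)%N]].
pose phi n := anc p (A n).
(* A first point other than the root would have positive weight, so the root would have to be listed
   before it. *)
have e0 : e 0%N = o.
  apply: contrapT => /eqP e0; case: (e_min 0%N o) => //.
  by rewrite W_root; apply: leq_ltn_trans (W_parent (elimN eqP e0)).
have Ao n : A n o by exists 0%N.
have AP n y := ancP (reaches_root y (Ao n)).
have phi_id n y : A n y -> phi n y = y by exact: anc_id.
have sub_A m n : (m <= n)%N -> A m `<=` A n.
  by move=> mn _ [i /= im <-]; exists i => //=; apply: leq_trans mn.
(* [N] is the largest weight among the points listed up to index [n]; every lighter point was listed
   earlier. *)
have prefix n : exists2 N, A n `<=` [set x | (W x <= N)%N] &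
    [set x | (W x < N)%N] `<=` A n.
  have [i0 i0n max_i0] : exists2 i0, (i0 <= n)%N &
      forall i, (i <= n)%N -> (W (e i) <= W (e i0))%N.
    elim: n => [|n [i0 i0n IH]]; first by exists 0%N => // -[].
    have [le|lt] := leqP (W (e n.+1)) (W (e i0)).
      exists i0 => [|i]; first exact: leqW.
      by rewrite leq_eqVlt => /predU1P[->//|/IH].
    exists n.+1 => // i; rewrite leq_eqVlt => /predU1P[->//|/IH le].
    exact: leq_trans le (ltnW lt).
  exists (W (e i0)) => [_ [i /= i_n <-]|x /= /e_min[i i_lt ->]]; first exact: max_i0.
  by exists i => //=; apply: leq_trans i0n; apply: ltnW.
(* Distinct points are at least [c] apart, so an additive error is at most [1 / c] times itself
   times their distance. *)
pose K := Num.max 1 (C1 + (`|C2| + `|C3| *+ 2) / c).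
exists K; first by rewrite le_max lexx.
exists phi, e; split.
- move=> n; split; last by move=> i i_n; apply: phi_id; exists i.
  apply/seteqP; split=> [_ [y _ <-]|x Ax]; first exact: (AP n y).1.
  by exists x => //; exact: phi_id.
- by apply/seteqP; split=> // z _; have [n <-] := e_surj z; exists n.
- move=> n y z; have [->|yz] := pselect (y = z).
    by rewrite !mdistxx mulr0.
  have [N AN NA] := prefix n.
  have Py := anc_prefix y (Ao n) AN NA; have Pz := anc_prefix z (Ao n) AN NA.
  have Lyz := dist_anc N y z; have sep := separated yz.
  have le1 : mdist (phi n y) (phi n z) <= C1 * mdist y z + (`|C2| + `|C3| *+ 2).
    apply: le_trans (metric_triangle _ (anc p [set x | (W x <= N)%N] y) _) _.
    apply: le_trans (lerD Py (metric_triangle _ (anc p [set x | (W x <= N)%N] z) _)) _.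
    rewrite metric_sym in Pz; have := ler_norm C2; rewrite mulr2n; lra.
  apply: le_trans le1 _.
  apply: (@le_trans _ _ ((C1 + (`|C2| + `|C3| *+ 2) / c) * mdist y z)).
    rewrite mulrDl lerD2l -mulrAC -mulrA ler_peMr ?addr_ge0 ?mulrn_wge0 //.
    by rewrite ler_pdivlMr // mul1r.
  by apply: ler_wpM2r; rewrite ?mdist_ge0 // le_max lexx orbT.
- move=> m n; apply/funext => y /=; have [mn|/ltnW nm] := leqP m n.
    exact: anc_anc (sub_A _ _ mn) (reaches_root _ (Ao m)).
  exact/phi_id/(sub_A n m nm)/((AP n y).1).
Qed.

End RetractionalBasisOfTree.

(** * Finite-dimensional subspaces *)

Lemma finite_preimage_inj (T U : Type) (A : set T) (F : set U) (f : T -> U) :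
  finite_set F -> (forall x, A x -> F (f x)) ->
  (forall x y, A x -> A y -> f x = f y -> x = y) -> finite_set A.
Proof.
move=> fF AF f_inj; apply: card_le_finite fF.
have : {in A &, injective f} by move=> x y; rewrite !inE; exact: f_inj.
move/inj_card_eq; rewrite card_eq_sym card_eq_le => /andP[le_A _].
by apply: card_le_trans le_A _; apply: subset_card_le => _ [x /AF Fx <-].
Qed.

Section FiniteDimensionalSubspaces.
Context (R : realType) (V : normedModType R).
Implicit Types (Y W : set V).

Definition is_subspace Y :=
  Y 0 /\ forall (t : R) x y, Y x -> Y y -> Y (t *: x + y).

Lemma subspaceD Y x y : is_subspace Y -> Y x -> Y y -> Y (x + y).
Proof. by move=> [_ Yl] Yx Yy; rewrite -[x]scale1r; apply: Yl. Qed.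

Lemma subspaceZ Y (t : R) x : is_subspace Y -> Y x -> Y (t *: x).
Proof. by move=> [Y0 Yl] Yx; rewrite -[_ *: _]addr0; apply: Yl. Qed.

Lemma subspaceB Y x y : is_subspace Y -> Y x -> Y y -> Y (x - y).
Proof.
by move=> sY Yx Yy; rewrite -scaleN1r; apply: subspaceD => //; exact: subspaceZ.
Qed.

Definition add_line W (e : V) : set V := [set w + t *: e | w in W & t in [set: R]].

Lemma add_line_id W e : is_subspace W -> W e -> add_line W e = W.
Proof.
move=> sW We; apply/seteqP; split=> [_ [w Ww] [t _] <-|w Ww].
  by apply: subspaceD => //; exact: subspaceZ.
by exists w => //; exists 0 => //; rewrite scale0r addr0.
Qed.

(** A spanning family is adjoined one vector at a time; it need not be independent, so [e] may
    already lie in [W]. *)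
Lemma finite_dim_ind (P : set V -> Prop) : P [set 0] ->
  (forall W e, is_subspace W -> P W -> P (add_line W e)) ->
  forall Y, finite_dim_subspace Y -> is_subspace Y /\ P Y.
Proof.
move=> P0 PS Y [d [e ->]]; elim: d e => [|d IH] e.
  suff -> : [set \sum_i c i *: e i | c in [set: 'I_0 -> R]] = [set 0].
    split=> //; split=> // t x y -> ->; first by rewrite scaler0 addr0.
  apply/seteqP; split=> [_ [c _ <-]|_ ->]; first by rewrite big_ord0.
  by exists (fun=> 0); rewrite ?big_ord0.
have [sW PW] := IH (fun i => e (widen_ord (leqnSn d) i)).
set W := [set _ | _ in _] in sW PW.
suff -> : [set \sum_i c i *: e i | c in [set: 'I_d.+1 -> R]] = add_line W (e ord_max).
  split; last exact: PS.
  split=> [|t _ _ [w Ww [s _ <-]] [w' Ww' [s' _ <-]]].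
    by exists 0; [exact: sW.1|exists 0 => //; rewrite scale0r addr0].
  exists (t *: w + w'); first exact: sW.2.
  by exists (t * s + s') => //; rewrite scalerDr scalerA scalerDl addrACA.
apply/seteqP; split=> [_ [c _ <-]|_ [_ [c _ <-]] [t _ <-]].
  rewrite big_ord_recr /=; eexists; last by exists (c ord_max).
    by exists (c \o widen_ord (leqnSn d)).
(* [insub] recovers an index below [d]; the default [t] is the coefficient at the last index. *)
exists (fun i => oapp c t (insub (val i))) => //.
rewrite big_ord_recr /= insubF ?ltnn //=; congr (_ + _).
by apply: eq_bigr => i _; rewrite valK.
Qed.

Lemma closureP_norm (A : set V) x :
  closure A x <-> forall e, 0 < e -> exists2 y, A y & `|x - y| < e.
Proof.
split=> [Ax e e0|Ax B /nbhs_ballP[e /= e0 eB]].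
  by have [y [Ay]] := Ax _ (nbhsx_ballx x e e0); rewrite -ball_normE /=; exists y.
by have [y Ay xy] := Ax e e0; exists y; split=> //; apply: eB; rewrite -ball_normE.
Qed.

(** [d] witnesses that [e] is at positive distance from the closed set [W]; dividing by [t] reduces
    to this. *)
Lemma add_line_gap W e : is_subspace W -> closed W -> ~ W e ->
  exists2 d, 0 < d & forall w t, W w -> d * `|t| <= `|w + t *: e|.
Proof.
move=> sW cW nWe; have /existsNP[d /not_implyP[d0 dP]] :
    ~ (forall d, 0 < d -> exists2 y, W y & `|e - y| < d).
  by rewrite -closureP_norm => /cW.
exists d => // w t Ww; have [->|t0] := eqVneq t 0; first by rewrite normr0 mulr0.
rewrite leNgt; apply/negP => lt_d; apply: dP; exists (- t^-1 *: w).
  exact: subspaceZ.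
have -> : e - - t^-1 *: w = t^-1 *: (w + t *: e).
  by rewrite scaleNr opprK scalerDr scalerA mulVf // scale1r addrC.
by rewrite normrZ normfV mulrC ltr_pdivrMr ?normr_gt0.
Qed.

Lemma finite_dim_subspaceP Y : finite_dim_subspace Y -> is_subspace Y.
Proof. by case/(@finite_dim_ind (fun=> True)). Qed.

(** By the gap, the coefficients on [e] of approximants of [x] form a Cauchy sequence. If [s] is
    their limit, the components in [W] converge to [x - s *: e], which lies in [W] by closedness. *)
Lemma closed_add_line W e : is_subspace W -> closed W -> closed (add_line W e).
Proof.
move=> sW cW; have [We|nWe] := pselect (W e); first by rewrite add_line_id.
have [d d0 dP] := add_line_gap sW cW nWe.
move=> x /closureP_norm xP.
have /choice[f fP] : forall n : nat, exists wt : V * R,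
    W wt.1 /\ `|x - (wt.1 + wt.2 *: e)| < n.+1%:R^-1.
  move=> n; have [|_ [w Ww] [t _ <-]] := xP n.+1%:R^-1; first by rewrite invr_gt0.
  by exists (w, t).
pose t n := (f n).2; pose w n := (f n).1.
have near_x : (fun n => w n + t n *: e) @ \oo --> x.
  apply/cvgrPdist_lt => r r0; near=> n.
  apply: lt_trans (fP n).2 _; near: n; exact: near_infty_natSinv_lt (PosNum r0).
have : cvg (t @ \oo).
  apply: cauchy_cvg; apply: cauchy_exP => r r0.
  have [N NP] : exists N : nat, N.+1%:R^-1 < d * r / 2.
    exists (Num.truncn (d * r / 2)^-1).
    by rewrite -ltf_pV2 ?posrE ?invr_gt0 ?divr_gt0 ?mulr_gt0 // invrK truncnS_gt.
  exists (t N); exists N => // n /= Nn; rewrite -ball_normE /=.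
  rewrite -(ltr_pM2l d0); apply: le_lt_trans (dP (w N - w n) _ _) _.
    by apply: subspaceB => //; exact: (fP _).1.
  have -> : w N - w n + (t N - t n) *: e =
      (x - (w n + t n *: e)) - (x - (w N + t N *: e)).
    by rewrite opprB [RHS]addrC subrKA opprD addrACA -scalerBl.
  apply: le_lt_trans (ler_normB _ _) _.
  apply: le_lt_trans (lerD (ltW (fP n).2) (ltW (fP N).2)) _.
  have : n.+1%:R^-1 <= N.+1%:R^-1 :> R by rewrite lef_pV2 ?posrE // ler_nat.
  move: NP; move: (N.+1%:R^-1) (n.+1%:R^-1) (d * r) => u v q; lra.
move=> /cvg_ex[/= s ts].
exists (x - s *: e); last by exists s => //; rewrite subrK.
apply: (@closed_cvg _ _ \oo _ w) => //; first by apply: nearW => n; exact: (fP n).1.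
have -> : w = (fun n => (w n + t n *: e) - t n *: e).
  by apply/funext => n; rewrite addrK.
by apply: cvgB => //; apply: cvgZr_tmp.
Unshelve. all: by end_near. Qed.

Lemma closed_origin : closed [set 0 : V].
Proof. exact/accessible_closed_set1/hausdorff_accessible/norm_hausdorff. Qed.

Lemma closed_finite_dim Y : finite_dim_subspace Y -> closed Y.
Proof.
move=> fY; suff [] : is_subspace Y /\ closed Y by [].
move: Y fY; apply: finite_dim_ind => [|W e]; first exact: closed_origin.
exact: closed_add_line.
Qed.

(** The finite net may lie outside [A]. *)
Definition totally_bounded (A : set V) :=
  forall e, 0 < e -> exists2 F : set V, finite_set F &
    forall x, A x -> exists2 y, F y & `|x - y| <= e.

Lemma segment_totally_bounded (T e : R) : 0 < e ->
  exists2 F : set R, finite_set F &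
    forall t, `|t| <= T -> exists2 s, F s & `|t - s| <= e.
Proof.
move=> e0; exists [set k%:R * e - T | k in [set k | (k <= Num.truncn (2 * T / e))%N]].
  by apply: finite_image; exact: (finite_II (Num.truncn (2 * T / e)).+1).
move=> t; rewrite ler_norml => /andP[Tt tT].
have T_ge : 0 <= (t + T) / e by apply: divr_ge0; lra.
exists ((Num.truncn ((t + T) / e))%:R * e - T).
  exists (Num.truncn ((t + T) / e)) => //=; apply: le_truncn.
  by rewrite ler_pM2r ?invr_gt0 //; lra.
have /andP[le1 lt1] := truncn_itv T_ge.
move: le1; rewrite ler_pdivlMr // => le1.
have : t + T < ((Num.truncn ((t + T) / e))%:R + 1) * e by rewrite natr1 -ltr_pdivrMr.
rewrite mulrDl mul1r => lt2; rewrite ler_norml; lra.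
Qed.

(** Closedness is carried through the induction because it yields the gap [d]. The gap bounds the
    coefficient on [e] by [r / d], hence also the component in [W], and nets for the two are
    combined. *)
Lemma totally_bounded_finite_dim Y r : finite_dim_subspace Y ->
  totally_bounded [set x | Y x /\ `|x| <= r].
Proof.
move=> fY; move: r; suff [_ []//] : is_subspace Y /\
    (closed Y /\ forall r, totally_bounded [set x | Y x /\ `|x| <= r]).
move: Y fY; apply: finite_dim_ind.
  split; first exact: closed_origin.
  move=> r e e0; exists [set 0]; first exact: finite_set1.
  by move=> _ [-> _]; exists 0; rewrite // subr0 normr0 ltW.
move=> W e sW [cW tW]; split; first exact: closed_add_line.
have [We|nWe] := pselect (W e); first by rewrite add_line_id.
have [d d0 dP] := add_line_gap sW cW nWe.
move=> r h h0; have e_gt0 : 0 < `|e|.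
  by rewrite normr_gt0; apply/eqP => e0; apply: nWe; rewrite e0; exact: sW.1.
have [F fF FP] := tW (r + r / d * `|e|) (h / 2) ltac:(by apply: divr_gt0).
have h2e : 0 < h / 2 / `|e| by rewrite !divr_gt0.
have [G fG GP] := segment_totally_bounded (r / d) h2e.
exists [set w + t *: e | w in F & t in G]; first exact: finite_image2.
move=> _ [[w Ww] [t _ <-] le_r].
have t_le : `|t| <= r / d.
  by rewrite ler_pdivlMr // mulrC; apply: le_trans le_r; exact: dP.
have [w' Fw' w'P] : exists2 y, F y & `|w - y| <= h / 2.
  apply: FP; split=> //; rewrite -(addrK (t *: e) w).
  apply: le_trans (ler_normB _ _) _; apply: lerD => //.
  by rewrite normrZ ler_wpM2r.
have [s Gs sP] := GP t t_le.
exists (w' + s *: e); first by exists w' => //; exists s.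
rewrite opprD addrACA -scalerBl; apply: le_trans (ler_normD _ _) _.
rewrite normrZ; move: sP; rewrite ler_pdivlMr // => sP; lra.
Qed.

(** Points of [A] with a common neighbour in a finite [c / 3]-net are closer than [c], hence
    equal. *)
Lemma finite_separated_bounded Y (A : set V) (r c : R) : finite_dim_subspace Y ->
  0 < c -> A `<=` [set x | Y x /\ `|x| <= r] ->
  (forall x y, A x -> A y -> x <> y -> c <= `|x - y|) -> finite_set A.
Proof.
move=> fY c0 AY sepA.
have [F fF FP] := totally_bounded_finite_dim r fY (divr_gt0 c0 (ltr0Sn _ 2)).
have /choice[f fP] : forall x, exists y, A x -> F y /\ `|x - y| <= c / 3.
  move=> x; have [/AY/FP[y Fy xy]|nAx] := pselect (A x); first by exists y.
  by exists 0.
apply: (finite_preimage_inj (f := f) fF) => [x /fP[]//|].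
move=> x y Ax Ay fxy; apply: contrapT => xy.
have := sepA x y Ax Ay xy; have [_ xP] := fP x Ax; have [_ yP] := fP y Ay.
have := ler_distD (f x) x y; rewrite {2}fxy [`|f y - y|]distrC; lra.
Qed.

End FiniteDimensionalSubspaces.

(** * The decomposition constant *)

Section DecompositionConstant.
Context (R : realType) (X : completeNormedModType R).

Lemma cvg_dyadic (u : nat -> X) (K : R) : 0 <= K ->
  (forall m n, (m <= n)%N -> `|u n - u m| <= K / 2 ^+ m) ->
  exists2 l, u @ \oo --> l & forall m, `|l - u m| <= K / 2 ^+ m.
Proof.
move=> K0 uP; have small (e : R) : 0 < e -> exists m, K / 2 ^+ m < e.
  move=> e0; exists (Num.truncn (K / e)).+1.
  rewrite ltr_pdivrMr ?exprn_gt0 // mulrC -ltr_pdivrMr //.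
  apply: lt_le_trans (truncnS_gt _) _.
  by rewrite -natrX ler_nat; apply/ltnW/ltn_expl.
have /cvg_ex[/= l ul] : cvg (u @ \oo).
  apply: cauchy_cvg; apply: cauchy_exP => e /small[m me].
  exists (u m); exists m => // n /= mn; rewrite -ball_normE /= distrC.
  by apply: le_lt_trans me; exact: uP.
exists l => // m; apply/ler_addgt0Pl => e e0.
have /cvgrPdist_lt/(_ e e0)[N _ NP] := ul.
have -> : l - u m = (l - u (maxn m N)) + (u (maxn m N) - u m) by rewrite addrA subrK.
apply: le_trans (ler_normD _ _) (lerD (ltW (NP _ _)) (uP _ _ _)).
  exact: leq_maxr.
exact: leq_maxl.
Qed.

Context (Xs : nat -> set X).
Hypothesis fdd : is_FDD Xs.

Let sX n : is_subspace (Xs n).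
Proof. by apply: finite_dim_subspaceP; exact: (fdd.1 n).1. Qed.
Let cX n : closed (Xs n).
Proof. by apply: closed_finite_dim; exact: (fdd.1 n).1. Qed.

Lemma fdd_coordinates : exists dec : X -> nat -> X,
  [/\ forall x n, Xs n (dec x n),
      forall x, series (dec x) @ \oo --> x
    & forall x u, (forall n, Xs n (u n)) -> series u @ \oo --> x -> dec x = u].
Proof.
have [dec decP] := choice fdd.2.
exists dec; split=> [x n|x|x u Xu ux]; first exact: (decP x).1.1.
  exact: (decP x).1.2.
exact: (decP x).2.
Qed.

Context (dec : X -> nat -> X).
Hypothesis decX : forall x n, Xs n (dec x n).
Hypothesis decS : forall x, series (dec x) @ \oo --> x.
Hypothesis dec_uniq : forall x u,
  (forall n, Xs n (u n)) -> series u @ \oo --> x -> dec x = u.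

Lemma dec_linear (t : R) x y n : dec (t *: x + y) n = t *: dec x n + dec y n.
Proof.
suff -> : dec (t *: x + y) = fun n => t *: dec x n + dec y n by [].
apply: dec_uniq => [m|]; first exact: (sX m).2.
have -> : series (fun n => t *: dec x n + dec y n) =
    (fun m => t *: series (dec x) m + series (dec y) m).
  by apply/funext => m; rewrite /series /= big_split scaler_sumr.
by apply: cvgD; [apply: cvgZl_tmp|].
Qed.

Definition partial_sum n x := series (dec x) n.
Local Notation P := partial_sum.

Lemma partial_sum_linear n (t : R) x y : P n (t *: x + y) = t *: P n x + P n y.
Proof.
rewrite /partial_sum /series /= scaler_sumr -big_split.
by apply: eq_bigr => i _; rewrite dec_linear.
Qed.

Lemma partial_sum0 n : P n 0 = 0.
Proof.
have := partial_sum_linear n 1 0 0; rewrite scaler0 addr0 scale1r => /eqP.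
by rewrite eq_sym -subr_eq0 addrK => /eqP.
Qed.

Lemma partial_sumZ n (t : R) x : P n (t *: x) = t *: P n x.
Proof. by rewrite -[t *: x]addr0 partial_sum_linear partial_sum0 addr0. Qed.

Lemma partial_sumB n x y : P n (x - y) = P n x - P n y.
Proof. by rewrite addrC -scaleN1r partial_sum_linear scaleN1r addrC. Qed.

Let A (k : R) := [set x | forall n, `|P n x| <= k].

Lemma partial_sums_bounded x : exists k : nat, A k%:R x.
Proof.
have /cvg_seq_bounded : cvg (series (dec x) @ \oo) by apply/cvg_ex; exists x.
move=> [M [_ MP]]; exists (Num.truncn (M + 1)).+1 => n.
apply: ltW; apply: le_lt_trans (truncnS_gt (M + 1)).
by apply: (MP (M + 1)) => //; rewrite ltrDl.
Qed.

(** Convergent partial sums are bounded, so the sets [A k] cover the space and, by Baire, the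
    closure of one of them has an interior point. *)
Lemma baire_closure_ball : exists x0 (r k : R),
  [/\ 0 < r, 0 <= k & forall y, `|y - x0| < r -> closure (A k) y].
Proof.
have : exists k : nat, ~ dense (~` closure (A k%:R)).
  apply: contrapT => /forallNP dA.
  have : dense (\bigcap_k ~` closure (A (k : nat)%:R)).
    apply: Baire => k; split; last by apply: contrapT; exact: dA.
    exact/closed_openC/closed_closure.
  move=> dI; have [| |x [_ xP]] := dI setT; [by exists 0|exact: openT|].
  have [k Ak] := partial_sums_bounded x.
  exact/(xP k I)/subset_closure.
move=> [k /denseNE[U [[x0 /open_nbhs_nbhs/nbhs_ballP[r /= r0 rU]] U0]]].
exists x0, r, k%:R; split=> // y yr; apply: contrapT => nA.
have : (U `&` ~` closure (A k%:R)) y.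
  by split=> //; apply: rU; rewrite -ball_normE /= distrC.
by rewrite U0.
Qed.

(* The open mapping argument for the norm [sup_n |P n x|]. *)
Lemma half_approximation : exists2 C : R, 0 <= C &
  forall y, exists2 z, (forall n, `|P n z| <= C * `|y|) & `|y - z| <= `|y| / 2.
Proof.
have [x0 [r [k [r0 k0 xP]]]] := baire_closure_ball.
(* Approximating [x0 + y] and [x0] from [A k] and subtracting moves the ball to the origin and
   doubles the bound. *)
have approx y e : `|y| < r -> 0 < e -> exists2 z, A (2 * k) z & `|y - z| < e.
  move=> yr e0; have e20 : 0 < e / 2 by rewrite divr_gt0.
  have /closureP_norm/(_ _ e20)[z1 Az1 z1P] : closure (A k) (x0 + y).
    by apply: xP; rewrite addrAC subrr add0r.
  have /closureP_norm/(_ _ e20)[z2 Az2 z2P] : closure (A k) x0.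
    by apply: xP; rewrite subrr normr0.
  exists (z1 - z2) => [n|].
    rewrite partial_sumB; apply: le_trans (ler_normB _ _) _.
    by rewrite mulr_natl mulr2n; apply: lerD; [exact: Az1|exact: Az2].
  have -> : y - (z1 - z2) = (x0 + y - z1) - (x0 - z2).
    by rewrite !opprB [RHS]addrC -[x0 + y - z1]addrA addrA subrK addrCA.
  by apply: le_lt_trans (ler_normB _ _) _; rewrite [e]splitr ltrD.
(* Rescale [y] to norm [r / 2] and approximate within [r / 4]; scaling back turns [2 * k] into
   [4 * k / r] times the norm of [y], and [r / 4] into half that norm. *)
exists (4 * k / r) => [|y]; first by rewrite !mulr_ge0 ?invr_ge0 // ltW.
have [->|y0] := eqVneq y 0.
  exists 0 => [n|]; first by rewrite partial_sum0 !normr0 mulr0.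
  by rewrite subrr normr0 mul0r.
have yn : 0 < `|y| by rewrite normr_gt0.
pose s := r / 2 / `|y|; have s0 : 0 < s by rewrite !divr_gt0.
have [| |z zP yz] := approx (s *: y) (r / 4).
- by rewrite normrZ gtr0_norm // /s divfK ?gt_eqF //; lra.
- by rewrite divr_gt0.
exists (s^-1 *: z) => [n|].
  rewrite partial_sumZ normrZ gtr0_norm ?invr_gt0 //.
  apply: (@le_trans _ _ (s^-1 * (2 * k))).
    by apply: ler_wpM2l (zP n); rewrite invr_ge0 ltW.
  rewrite le_eqVlt; apply/orP; left; apply/eqP; rewrite /s; field.
  by rewrite !gt_eqF.
have -> : y - s^-1 *: z = s^-1 *: (s *: y - z).
  by rewrite scalerBr scalerA mulVf ?gt_eqF // scale1r.
rewrite normrZ gtr0_norm ?invr_gt0 //.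
apply: (@le_trans _ _ (s^-1 * (r / 4))).
  by apply: ler_wpM2l (ltW yz); rewrite invr_ge0 ltW.
rewrite le_eqVlt; apply/orP; left; apply/eqP; rewrite /s; field.
by rewrite !gt_eqF.
Qed.

Lemma fdd_constant : exists2 D : R, 0 <= D &
  forall x n, `|partial_sum n x| <= D * `|x|.
Proof.
have [C C0 gP] := half_approximation.
have /choice[g gP2] : forall y, exists z,
    (forall n, `|P n z| <= C * `|y|) /\ `|y - z| <= `|y| / 2.
  by move=> y; have [z] := gP y; exists z.
have gA y n : `|P n (g y)| <= C * `|y| := (gP2 y).1 n.
have gH y : `|y - g y| <= `|y| / 2 := (gP2 y).2.
exists (2 * C) => [|x]; first by rewrite mulr_ge0.
(* [y i] is the residual after [i] approximations, so [x - y n] is the sum of the first [n] of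
   them. *)
pose y i := iter i (fun y => y - g y) x.
have yS i : `|y i| <= `|x| / 2 ^+ i.
  elim: i => [|i IH]; first by rewrite expr0 divr1.
  rewrite exprS invfM mulrCA mulrC; apply: le_trans (gH (y i)) _.
  by apply: ler_wpM2r => //; rewrite invr_ge0.
pose K := 2 * C * `|x|; have K0 : 0 <= K by rewrite !mulr_ge0.
have ysub m n j : (m <= n)%N -> `|P j (x - y n) - P j (x - y m)| <= K / 2 ^+ m.
  move=> mn; rewrite -(subnK mn); move: (n - m)%N => {n mn} d.
  elim: d m => [|d IH] m.
    by rewrite add0n subrr normr0 divr_ge0 ?exprn_ge0.
  have -> : P j (x - y (d.+1 + m)%N) - P j (x - y m) =
      (P j (x - y (d + m.+1)%N) - P j (x - y m.+1)) + P j (g (y m)).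
    have -> : P j (g (y m)) = P j (x - y m.+1) - P j (x - y m).
      rewrite -partial_sumB; congr P.
      rewrite [y m.+1]/(y m - g (y m)) !opprB [RHS]addrC.
      by rewrite addrA subrK addrC subrK.
    by rewrite addrA subrK addSnnS.
  apply: le_trans (ler_normD _ _) _.
  apply: le_trans (lerD (IH _) (gA _ _)) _.
  have le_y : C * `|y m| <= C * `|x| / 2 ^+ m by rewrite -mulrA ler_wpM2l.
  apply: le_trans (lerD (lexx _) le_y) _.
  rewrite le_eqVlt; apply/orP; left; apply/eqP; rewrite /K exprS; field.
  by rewrite gt_eqF // exprn_gt0.
have /choice[l lP] : forall j, exists lj,
    (fun n => P j (x - y n)) @ \oo --> lj /\
    forall m, `|lj - P j (x - y m)| <= K / 2 ^+ m.
  move=> j; have [m n mn|lj] := @cvg_dyadic (fun n => P j (x - y n)) K K0.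
    exact: ysub.
  by exists lj.
have l0 : l 0%N = 0.
  apply: (@norm_cvg_unique _ _ _ _ _ _ (lP 0%N).1).
  rewrite /partial_sum /series /=; under eq_fun do rewrite big_nil; exact: cvg_cst.
(* The increments of [l] are the candidate coordinates of [x]: they are limits of vectors of the
   closed subspaces [Xs j]. *)
pose v j := l j.+1 - l j.
have Xv j : Xs j (v j).
  apply: (@closed_cvg _ _ \oo _ (fun n => P j.+1 (x - y n) - P j (x - y n))) => //.
    apply: nearW => n; rewrite /partial_sum /series /= big_nat_recr //= addrAC subrr add0r.
    exact: decX.
  by apply: cvgB; exact: (lP _).1.
have vE : series v = l.
  by apply/funext => n; rewrite /series /= telescope_sumr // l0 subr0.
have vx : series v @ \oo --> x.
  rewrite vE; apply/cvgrPdist_lt => e e0.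
  pose B := `|x| + K.
  have [m mP] : exists m, B / 2 ^+ m < e / 2.
    exists (Num.truncn (B / (e / 2))).+1.
    rewrite ltr_pdivrMr ?exprn_gt0 // mulrC -ltr_pdivrMr ?divr_gt0 //.
    apply: lt_le_trans (truncnS_gt _) _.
    by rewrite -natrX ler_nat; apply/ltnW/ltn_expl.
  have /cvgrPdist_lt/(_ (e / 2))[|N _ NP] := @decS (x - y m); first by rewrite divr_gt0.
  exists N => // n /NP /= lt_n.
  (* Three errors: the residual, the convergence of the expansion of [x - y m], and the uniform
     error of stage [m]. *)
  have -> : x - l n = y m + (x - y m - P n (x - y m)) - (l n - P n (x - y m)).
    by rewrite opprB [y m + _]addrA [y m + _]addrC subrK addrA subrK.
  apply: le_lt_trans (ler_normB _ _) _.
  apply: le_lt_trans (lerD (ler_normD _ _) ((lP n).2 m)) _.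
  apply: le_lt_trans (lerD (lerD (yS m) (lexx _)) (lexx _)) _.
  move: mP lt_n; rewrite /B mulrDl /partial_sum.
  move: (`|x| / 2 ^+ m) (K / 2 ^+ m) (`|_|) => p q s; lra.
move=> n; rewrite /partial_sum (dec_uniq Xv vx) vE.
(* At stage [0] the residual is [x] itself, so the estimate bounds [l n] by [K]. *)
have := (lP n).2 0%N; rewrite /y /= subrr partial_sum0 subr0 expr0 divr1.
by [].
Qed.

End DecompositionConstant.

(** * Spiderwebs *)

Section SpiderwebParent.
Context (R : realType) (V : normedModType R) (a b : R) (Y N : set V).
Hypothesis subY : is_subspace Y.
Hypothesis webN : spiderweb_base a b Y N.

(* [b * (dyadic_gap n - dyadic_gap m)] bounds the change of direction of a point
   brought from layer [m] down to layer [n]: stepping inwards is radial except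
   from layer [2 ^ i.+1], where the direction moves by at most [b / 2 ^ i]. *)
Definition dyadic_gap (n : nat) : R := 2 / (2 ^ trunc_log 2 n)%:R.

Lemma dyadic_gapE i n : (2 ^ i <= n < 2 ^ i.+1)%N -> dyadic_gap n = 2 / (2 ^ i)%:R.
Proof. by rewrite /dyadic_gap => /(@trunc_log_eq 2 i n isT) ->. Qed.

Lemma dyadic_gap_le n : (0 < n)%N -> dyadic_gap n <= 4 / n%:R.
Proof.
move=> n0; have /andP[_ lt_n] := trunc_log_bounds (isT : (1 < 2)%N) n0.
rewrite /dyadic_gap ler_pdivrMr ?ltr0n ?expn_gt0 // mulrAC ler_pdivlMr ?ltr0n //.
by rewrite -!natrM ler_nat; move: lt_n; rewrite expnS; lia.
Qed.

Lemma scale_sphereP (n : nat) x :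
  scale_set n%:R (unit_sphere Y) x -> Y x /\ `|x| = n%:R.
Proof.
move=> [y [Yy y1] <-]; split; first exact: subspaceZ.
by rewrite normrZ y1 mulr1 normr_nat.
Qed.

Lemma scale_sphereI (n : nat) x : (0 < n)%N -> Y x -> `|x| = n%:R ->
  scale_set n%:R (unit_sphere Y) x.
Proof.
move=> n0 Yx xn; have n0' : n%:R != 0 :> R by rewrite pnatr_eq0 -lt0n.
exists (n%:R^-1 *: x); last by rewrite scalerA mulfV // scale1r.
split; first exact: subspaceZ.
by rewrite normrZ normfV normr_nat xn mulVf.
Qed.

Lemma spiderweb_mem x : N x -> Y x /\ `|x| = (Num.truncn `|x|)%:R.
Proof.
have [S [-> [SP _ _ _]]] := webN; move=> [n _ /(SP n).2/scale_sphereP[Yx ->]].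
by rewrite natrK.
Qed.

Lemma spiderweb0 : N 0.
Proof.
have [S [-> [SP _ _ _]]] := webN; have [[x S0x] /(_ x S0x)[y _ xE]] := SP 0%N.
by exists 0%N => //; move: S0x; rewrite -xE scale0r.
Qed.

(** Within a layer the net condition separates; points of different layers have distinct integers as
    norms. *)
Lemma spiderweb_separated x y : N x -> N y -> x <> y -> Num.min a 1 <= `|x - y|.
Proof.
have [S [-> [SP _ netS _]]] := webN; move=> [n _ Sx] [m _ Sy] xy.
have Qx := (SP n).2 _ Sx; have Qy := (SP m).2 _ Sy.
have [_ xn] := scale_sphereP Qx; have [_ ym] := scale_sphereP Qy.
rewrite ge_min; have [nm|nm] := eqVneq n m.
  subst m; case: n => [|n] in Sx Sy Qx Qy xn ym *.
    by case: xy; rewrite (normr0_eq0 xn) (normr0_eq0 ym).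
  apply/orP; left.
  pose T := metric_subspace (scale_set n.+1%:R (unit_sphere Y)).
  pose u : T := exist _ x (mem_set Qx); pose v : T := exist _ y (mem_set Qy).
  apply: ((netS n.+1 isT).1 u v) => //.
  by move=> /(congr1 val).
apply/orP; right; apply: le_trans (ler_dist_dist x y); rewrite xn ym.
move: nm; rewrite neq_ltn => /orP[lt|lt]; first rewrite distrC.
  by apply: le_trans (ler_norm _); rewrite -natrB ?ler1n ?subn_gt0 // ltnW.
by apply: le_trans (ler_norm _); rewrite -natrB ?ler1n ?subn_gt0 // ltnW.
Qed.

(** The layers from [2 ^ i] up to [2 ^ i.+1 - 1] are multiples of the first of them, so a
    predecessor there is exactly radial. For [x] in layer [2 ^ i.+1], halve [x], take a net point of
    layer [2 ^ i] within [b], and scale it out to the layer just below [x]. *)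
Lemma spiderweb_parent_exists x : exists y, N x -> forall n, `|x| = n.+1%:R ->
  [/\ N y, `|y| = n%:R & (0 < n)%N ->
      `|n%:R^-1 *: y - n.+1%:R^-1 *: x| <= b * (dyadic_gap n - dyadic_gap n.+1)].
Proof.
have N0 := spiderweb0.
have [S [NE [SP _ netS midS]]] := webN.
have [Nx|nNx] := pselect (N x); last by exists 0.
have [m _ Sx] : exists2 m, True & S m x by move: Nx; rewrite NE => -[m _]; exists m.
have [Yx xm] := scale_sphereP ((SP m).2 _ Sx).
have onlyn n : `|x| = n.+1%:R -> m = n.+1.
  by rewrite xm => /eqP; rewrite eqr_nat => /eqP.
case: m => [|[|n]] in Sx xm onlyn.
- by exists 0 => _ n /onlyn.
- by exists 0 => _ n /onlyn[<-]; split; rewrite ?normr0.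
have [i /andP[ile ilt]] : exists i, (2 ^ i <= n.+1 < 2 ^ i.+1)%N.
  by exists (trunc_log 2 n.+1); exact: trunc_log_bounds.
have p2i : (2 ^ i)%:R != 0 :> R by rewrite pnatr_eq0 -lt0n expn_gt0.
have mem z : S (2 ^ i)%N z -> N ((n.+1%:R / (2 ^ i)%:R) *: z) /\
    `|(n.+1%:R / (2 ^ i)%:R) *: z| = n.+1%:R.
  move=> Sz; have [_ zn] := scale_sphereP ((SP _).2 _ Sz).
  split; last by rewrite normrZ zn normrM normfV !normr_nat divfK.
  rewrite NE; exists n.+1 => //; have [<-|ne] := eqVneq (2 ^ i)%N n.+1.
    by rewrite divff // scale1r.
  rewrite (midS i); first by exists z.
    by case: i ne ile ilt {p2i Sz zn} => // ne ile ilt; lia.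
  by rewrite ilt andbT ltn_neqAle ne.
(* A point of layer [2 ^ i] with nearly the direction of [x] is enough: by [mem], its multiple of
   norm [n.+1] lies in the web. *)
suff main : exists2 z, S (2 ^ i)%N z &
    `|(2 ^ i)%:R^-1 *: z - n.+2%:R^-1 *: x| <= b * (dyadic_gap n.+1 - dyadic_gap n.+2).
  case: main => w Sw wP; exists ((n.+1%:R / (2 ^ i)%:R) *: w) => _ k /onlyn[<-].
  have [Nw nw] := mem w Sw; split=> // _.
  by rewrite scalerA mulrA mulVf ?mul1r // pnatr_eq0.
have gapn : dyadic_gap n.+1 = 2 / (2 ^ i)%:R by apply: dyadic_gapE; rewrite ile.
have [lt2|ge2] := ltnP n.+2 (2 ^ i.+1).
  have i0 : (0 < i)%N by case: i lt2 {p2i mem gapn ile ilt} => //; lia.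
  move: Sx; rewrite (midS i) ?lt2 ?andbT // => -[z Sz <-].
  exists z => //; rewrite scalerA mulrA mulVf ?pnatr_eq0 // mul1r subrr normr0.
  rewrite gapn (@dyadic_gapE i) ?subrr ?mulr0 //.
  by rewrite lt2 (leq_trans ile).
have En : n.+2 = (2 ^ i.+1)%N by apply/eqP; rewrite eqn_leq ge2 andbT.
have Eh : n.+2%:R = 2 * (2 ^ i)%:R :> R by rewrite En expnS natrM.
have Qx : scale_set (2 ^ i)%:R (unit_sphere Y) (2^-1 *: x).
  apply: scale_sphereI; rewrite ?expn_gt0 //; first exact: subspaceZ.
  by rewrite normrZ xm Eh ger0_norm ?invr_ge0 // mulrA mulVf ?mul1r // pnatr_eq0.
pose u : metric_subspace (scale_set (2 ^ i)%:R (unit_sphere Y)) :=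
  exist _ (2^-1 *: x) (mem_set Qx).
have [|v Sv vP] := (netS (2 ^ i)%N _).2 u.
  by rewrite expn_gt0.
exists (val v) => //.
have -> : (2 ^ i)%:R^-1 *: val v - n.+2%:R^-1 *: x =
    (2 ^ i)%:R^-1 *: (val v - 2^-1 *: x).
  by rewrite scalerBr scalerA Eh invfM [2^-1 * _]mulrC.
have -> : dyadic_gap n.+1 - dyadic_gap n.+2 = (2 ^ i)%:R^-1.
  have gapn2 : dyadic_gap n.+2 = 2 / n.+2%:R.
    have := @dyadic_gapE i.+1 n.+2; rewrite -En; apply.
    by rewrite leqnn En ltn_exp2l /= ?ltnS.
  rewrite gapn gapn2 Eh.
  by field.
rewrite normrZ normfV normr_nat mulrC ler_pM2r ?invr_gt0 ?lt0r ?p2i ?ler0n //.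
by rewrite distrC; exact: vP.
Qed.

(** The changes of direction telescope to at most [b * dyadic_gap (m - k)], hence [4 * b / (m - k)];
    multiplying by the radius [m - k] leaves a bound independent of [x] and [k]. *)
Lemma spiderweb_truncation : 0 < b -> exists q : V -> V,
  forall x k, N x -> (k <= Num.truncn `|x|)%N ->
    [/\ N (iter k q x), `|iter k q x| = `|x| - k%:R
      & `|iter k q x - ((`|x| - k%:R) / `|x|) *: x| <= 4 * b].
Proof.
move=> b0; have [q qP] := choice spiderweb_parent_exists.
exists q => x k Nx; have [_] := spiderweb_mem Nx; set m := Num.truncn _ => xm km.
have step : N (iter k q x) /\ `|iter k q x| = (m - k)%:R /\ ((k < m)%N ->
    `|(m - k)%:R^-1 *: iter k q x - m%:R^-1 *: x|
       <= b * (dyadic_gap (m - k) - dyadic_gap m)).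
  elim: k km => [|k IH] km.
    by rewrite subn0 /= !subrr normr0 mulr0.
  have [Nk [nk dk]] := IH (ltnW km).
  have [] := qP _ Nk (m - k.+1)%N; first by rewrite nk subnSK.
  rewrite subnSK // -iterS => Nk1 nk1 dk1; split=> //; split=> // km1.
  have := lerD (dk1 _) (dk km); rewrite subn_gt0 => /(_ km1) le.
  rewrite -[_ - m%:R^-1 *: x](subrKA ((m - k)%:R^-1 *: iter k q x)).
  apply: le_trans (ler_normD _ _) _; apply: le_trans le _.
  by rewrite -mulrDr addrA subrK.
case: step => Nk [nk dk]; split=> //; first by rewrite nk xm natrB.
rewrite xm -natrB //; have [km0|lt_km] := leqP m k.
  have mk0 : (m - k = 0)%N by apply/eqP; rewrite subn_eq0.
  move: nk; rewrite mk0 => /normr0_eq0 ->.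
  by rewrite mul0r scale0r subrr normr0 mulr_ge0 // ltW.
have le := dk lt_km.
have mk0 : (m - k)%:R != 0 :> R by rewrite pnatr_eq0 -lt0n subn_gt0.
have mk_gt0 : 0 < (m - k)%:R :> R by rewrite ltr0n subn_gt0.
have -> : iter k q x - ((m - k)%:R / m%:R) *: x =
    (m - k)%:R *: ((m - k)%:R^-1 *: iter k q x - m%:R^-1 *: x).
  by rewrite scalerBr !scalerA mulfV // scale1r.
rewrite normrZ normr_nat -ler_pdivlMl //; apply: le_trans le _.
have -> : (m - k)%:R^-1 * (4 * b) = b * (4 / (m - k)%:R) by ring.
rewrite ler_wpM2l ?(ltW b0) //.
apply: le_trans (dyadic_gap_le _); last by rewrite subn_gt0.
by rewrite gerBl /dyadic_gap divr_ge0.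
Qed.

End SpiderwebParent.

(** * Weighted truncation *)

Section RadialClip.
Context (R : realType) (V : normedModType R).

(** The radial retraction onto the ball of radius [t], for [t >= 0]. *)
Definition clip (t : R) (x : V) : V := if `|x| <= t then x else (t / `|x|) *: x.

Lemma clip_lipschitz (s t : R) (x y : V) : 0 <= s -> 0 <= t ->
  `|clip t x - clip s y| <= 2 * `|x - y| + `|t - s|.
Proof.
(* One point inside its ball and the other outside; the opposite case follows by symmetry. *)
have half (s' t' : R) (x' y' : V) : 0 <= s' -> `|x'| <= t' -> s' < `|y'| ->
    `|x' - (s' / `|y'|) *: y'| <= 2 * `|x' - y'| + `|t' - s'|.
  move=> s0 xt ys; have y0 : 0 < `|y'| by apply: le_lt_trans ys.
  have -> : x' - (s' / `|y'|) *: y' = (x' - y') + (1 - s' / `|y'|) *: y'.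
    by rewrite scalerBl scale1r addrA subrK.
  apply: le_trans (ler_normD _ _) _; rewrite normrZ.
  have q1 : s' / `|y'| <= 1 by rewrite ler_pdivrMr // mul1r ltW.
  rewrite (ger0_norm (_ : 0 <= 1 - _)) ?subr_ge0 // mulrBl mul1r divfK ?gt_eqF //.
  have := ler_norm (t' - s'); have := lerB_dist y' x'; rewrite distrC; lra.
move=> s0 t0; rewrite /clip; case: (leP `|x| t) => xt; case: (leP `|y| s) => ys.
- by have := normr_ge0 (t - s); have := normr_ge0 (x - y); lra.
- exact: half.
- by rewrite distrC [`|x - y|]distrC [`|t - s|]distrC; exact: half.
have x0 : 0 < `|x| by apply: le_lt_trans xt.
have y0 : 0 < `|y| by apply: le_lt_trans ys.
pose r := t / `|x|.
have r0 : 0 <= r by rewrite divr_ge0 // ltW.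
have r1 : r <= 1 by rewrite ler_pdivrMr // mul1r ltW.
have rx : r * `|x| = t by rewrite divfK ?gt_eqF.
rewrite -/r; clearbody r.
(* Both points outside: scale both by the ratio [r] of [x], then correct the factor of [y]. *)
have -> : r *: x - (s / `|y|) *: y = r *: (x - y) + (r - s / `|y|) *: y.
  by rewrite scalerBr scalerBl addrA subrK.
apply: le_trans (ler_normD _ _) _; rewrite !normrZ (ger0_norm r0).
have -> : `|r - s / `|y| | * `|y| = `|r * `|y| - s|.
  by rewrite -{2}(ger0_norm (ltW y0)) -normrM mulrBl divfK ?gt_eqF.
have -> : r * `|y| - s = r * (`|y| - `|x|) + (t - s).
  by rewrite mulrBr rx addrA subrK.
have le1 : r * `|x - y| <= `|x - y| by rewrite ler_piMl.
have le2 : `|r * (`|y| - `|x|)| <= `|x - y|.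
  rewrite normrM (ger0_norm r0); apply: le_trans (ler_piMl _ r1) _ => //.
  by rewrite distrC; exact: ler_dist_dist.
have := ler_normD (r * (`|y| - `|x|)) (t - s); lra.
Qed.

End RadialClip.

(** * Parents, weights and truncation of coordinate sequences *)

Section WeightedTruncation.
Context (R : realType) (X : normedModType R) (B : nat -> set X).
Context (q : nat -> X -> X) (beta : R).
Implicit Types (u v w : nat -> X).

Definition layer (x : X) : nat := Num.truncn `|x|.

Hypothesis B_layer : forall i x, B i x -> `|x| = (layer x)%:R.
Hypothesis B0 : forall i, B i 0.
Hypothesis q_trunc : forall i x k, B i x -> (k <= layer x)%N ->
  [/\ B i (iter k (q i) x), `|iter k (q i) x| = `|x| - k%:R
    & `|iter k (q i) x - ((`|x| - k%:R) / `|x|) *: x| <= beta].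

Lemma layer0 : layer 0 = 0%N. Proof. by rewrite /layer normr0 truncn0. Qed.

Lemma layer_gt0 i x : B i x -> x != 0 -> (0 < layer x)%N.
Proof. by move=> Bx; rewrite -normr_gt0 (B_layer Bx) ltr0n. Qed.

Lemma layer_iter i x k : B i x -> (k <= layer x)%N ->
  layer (iter k (q i) x) = (layer x - k)%N.
Proof.
move=> Bx kx; have [_ nx _] := q_trunc Bx kx.
by rewrite {1}/layer nx (B_layer Bx) -natrB // natrK.
Qed.

Definition finsupp u := exists n, forall i, (n <= i)%N -> u i = 0.

Definition grid_seq u := (forall i, B i (u i)) /\ finsupp u.

Definition supp_len u : nat :=
  if pselect (exists n, `[< forall i, (n <= i)%N -> u i = 0 >]) is left h
  then ex_minn h else 0%N.

Lemma supp_lenP u : finsupp u ->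
  (forall i, (supp_len u <= i)%N -> u i = 0) /\
  (forall n, (forall i, (n <= i)%N -> u i = 0) -> (supp_len u <= n)%N).
Proof.
move=> [n un]; rewrite /supp_len; case: pselect => [h|[]]; last first.
  by exists n; apply/asboolP.
case: ex_minnP => m /asboolP um min_m; split=> // k uk.
by apply: min_m; apply/asboolP.
Qed.

Lemma supp_len_last u j : finsupp u -> supp_len u = j.+1 -> u j != 0.
Proof.
move=> fu uj; apply/eqP => uj0; have [u0 min_u] := supp_lenP fu.
suff : (supp_len u <= j)%N by rewrite uj ltnn.
apply: min_u => i; rewrite leq_eqVlt => /predU1P[<-//|ji]; apply: u0.
by rewrite uj.
Qed.

Lemma supp_lenE u j : u j != 0 -> (forall i, (j < i)%N -> u i = 0) ->
  supp_len u = j.+1.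
Proof.
move=> uj uz; have fu : finsupp u by exists j.+1.
have [u0 min_u] := supp_lenP fu; apply/eqP; rewrite eqn_leq min_u //=.
by rewrite ltnNge; apply: contra uj => /u0 ->.
Qed.

Definition weight u n : nat := (\sum_(i < n) 2 ^ i * layer (u i))%N.

Definition total_weight u : nat := weight u (supp_len u).

Lemma weight_recr u n : weight u n.+1 = (weight u n + 2 ^ n * layer (u n))%N.
Proof. by rewrite /weight big_ord_recr. Qed.

Lemma leq_weight u m n : (m <= n)%N -> (weight u m <= weight u n)%N.
Proof.
move=> /subnK <-; elim: (n - m)%N => // d IH.
by rewrite addSn weight_recr; apply: leq_trans IH (leq_addr _ _).
Qed.

Lemma weight_stationary u m n : (m <= n)%N -> (forall i, (m <= i)%N -> u i = 0) ->
  weight u n = weight u m.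
Proof.
move=> /subnK <- um; elim: (n - m)%N => // d IH.
by rewrite addSn weight_recr um ?leq_addl // layer0 muln0 addn0.
Qed.

Lemma total_weightE u n : (forall i, (n <= i)%N -> u i = 0) ->
  total_weight u = weight u n.
Proof.
move=> un; have [u0 min_u] := supp_lenP (ex_intro _ n un).
by rewrite /total_weight -(weight_stationary (min_u _ un) u0).
Qed.

Lemma weight_le_total u n : finsupp u -> (weight u n <= total_weight u)%N.
Proof.
move=> fu; have [u0 _] := supp_lenP fu; have [le|/ltnW le] := leqP n (supp_len u).
  exact: leq_weight.
by rewrite /total_weight (weight_stationary le).
Qed.

Lemma eq_weight u v n : (forall i, (i < n)%N -> u i = v i) ->
  weight u n = weight v n.
Proof. by move=> uv; apply: eq_bigr => i _; rewrite uv. Qed.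

(** The common shape of the nonzero ancestors of a grid sequence, see [iter_parent]. *)
Definition cut u j l : nat -> X :=
  fun i => if (i < j)%N then u i else if i == j then iter l (q j) (u j) else 0.

Definition parent u : nat -> X :=
  if supp_len u is j.+1 then cut u j 1 else u.

Lemma cutl u j l i : (i < j)%N -> cut u j l i = u i.
Proof. by rewrite /cut => ->. Qed.

Lemma cutj u j l : cut u j l j = iter l (q j) (u j).
Proof. by rewrite /cut ltnn eqxx. Qed.

Lemma cutr u j l i : (j < i)%N -> cut u j l i = 0.
Proof. by rewrite /cut => ji; rewrite ltnNge ltnW //= gtn_eqF. Qed.

Lemma cut_eq u v j l : (forall i, (i < j)%N -> v i = u i) ->
  v j = iter l (q j) (u j) -> (forall i, (j < i)%N -> v i = 0) -> v = cut u j l.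
Proof.
move=> vl vj vr; apply/funext => i; have [ij|ji|->] := ltngtP i j.
- by rewrite cutl // vl.
- by rewrite cutr // vr.
- by rewrite cutj vj.
Qed.

Lemma grid_seq_cut u j l : grid_seq u -> (l <= layer (u j))%N ->
  grid_seq (cut u j l).
Proof.
move=> [Bu _] lj; split; last by exists j.+1 => i; exact: cutr.
move=> i; have [ij|ji|->] := ltngtP i j.
- by rewrite cutl.
- by rewrite cutr.
- by rewrite cutj; case: (q_trunc (Bu j) lj).
Qed.

Lemma grid_seqE u : grid_seq u -> u = (fun=> 0) \/
  exists j, [/\ supp_len u = j.+1, u j != 0 & u = cut u j 0].
Proof.
move=> [_ fu]; have [u0 _] := supp_lenP fu; case E: (supp_len u) => [|j].
  by left; apply/funext => i; rewrite u0 // E.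
right; exists j; split=> //; first exact: supp_len_last.
by apply: cut_eq => // i ji; apply: u0; rewrite E.
Qed.

Lemma parent0 : parent (fun=> 0) = (fun=> 0).
Proof.
have [_ min_u] := @supp_lenP (fun=> 0) (ex_intro _ 0%N (fun _ _ => erefl)).
by have := min_u 0%N (fun _ _ => erefl); rewrite leqn0 /parent => /eqP ->.
Qed.

Lemma parent_cut u j l : grid_seq u -> (l < layer (u j))%N ->
  parent (cut u j l) = cut u j l.+1.
Proof.
move=> [Bu _] lj; rewrite /parent (@supp_lenE _ j); last by move=> i; exact: cutr.
  apply: cut_eq => [i ij||i ji]; first by rewrite !cutl.
    by rewrite !cutj.
  by rewrite cutr.
rewrite cutj -normr_eq0; have [_ -> _] := q_trunc (Bu j) (ltnW lj).
by rewrite (B_layer (Bu j)) -natrB ?(ltnW lj) // pnatr_eq0 subn_eq0 -ltnNge.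
Qed.

Lemma parentE u j : supp_len u = j.+1 -> parent u = cut u j 1.
Proof. by rewrite /parent => ->. Qed.

Lemma grid_seq_parent u : grid_seq u -> grid_seq (parent u).
Proof.
move=> gu; have [->|[j [uj uj0 _]]] := grid_seqE gu.
  by rewrite parent0; split=> //; exists 0%N.
by rewrite (parentE uj); apply: grid_seq_cut => //; exact: layer_gt0 (gu.1 j) uj0.
Qed.

Lemma total_weight_cut u j l : grid_seq u -> (l <= layer (u j))%N ->
  total_weight (cut u j l) = (weight u j + 2 ^ j * (layer (u j) - l))%N.
Proof.
move=> [Bu _] lj; rewrite (@total_weightE _ j.+1) => [|i]; last exact: cutr.
rewrite weight_recr cutj (layer_iter (Bu j)) //; congr (_ + _)%N.
by apply: eq_weight => i; exact: cutl.
Qed.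

Lemma total_weight_parent u : grid_seq u -> u <> (fun=> 0) ->
  (total_weight (parent u) < total_weight u)%N.
Proof.
move=> gu; have [//|[j [uj uj0 uE]] _] := grid_seqE gu.
have l0 := layer_gt0 (gu.1 j) uj0.
have -> : total_weight u = (weight u j + 2 ^ j * layer (u j))%N.
  by rewrite {1}uE total_weight_cut // subn0.
rewrite (parentE uj) total_weight_cut // ltn_add2l ltn_pmul2l ?expn_gt0 //.
by rewrite ltn_subrL l0.
Qed.

(** A parent step increments [l] until coordinate [j] reaches [0]. The last nonzero coordinate is
    then an earlier one, still untouched, and the description restarts there with [l = 0]. *)
Lemma iter_parent u k : grid_seq u -> iter k parent u = (fun=> 0) \/
  exists j l, (l < layer (u j))%N /\ iter k parent u = cut u j l.
Proof.
move=> gu; elim: k => [|k [IH|[j [l [lj IH]]]]].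
- have [->|[j [_ uj uE]]] := grid_seqE gu; first by left.
  by right; exists j, 0%N; split=> //; exact: layer_gt0 (gu.1 j) uj.
- by left; rewrite iterS IH parent0.
rewrite iterS IH parent_cut //.
have [->|[j' [_ uj' uE]]] := grid_seqE (grid_seq_cut gu lj); first by left.
right; have [lt|gt|e] := ltngtP j' j.
- exists j', 0%N; split.
    by apply: layer_gt0 (gu.1 j') _; rewrite cutl in uj'.
  rewrite uE; apply: cut_eq => [i ij||i ji].
  + by rewrite cutl // cutl // (ltn_trans ij).
  + by rewrite cutj /= cutl.
  + by rewrite cutr.
- by rewrite cutr // eqxx in uj'.
- exists j, l.+1; split=> //; rewrite ltn_neqAle lj andbT; apply/eqP => e2.
  move: uj'; rewrite e cutj -normr_eq0; have [_ -> _] := q_trunc (gu.1 j) lj.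
  by rewrite (B_layer (gu.1 j)) e2 subrr eqxx.
Qed.

(* The radius left for the [j]-th coordinate in the set of sequences of weight
   at most [N], once the coordinates before [j] are fixed. *)
Definition budget (N : nat) u j : R := (N%:R - (weight u j)%:R) / (2 ^ j)%:R.

Lemma clip_budget_id N u j : grid_seq u -> (weight u j.+1 <= N)%N ->
  clip (budget N u j) (u j) = u j.
Proof.
move=> [Bu _]; rewrite weight_recr => le_N; rewrite /clip ifT //.
rewrite (B_layer (Bu j)) /budget ler_pdivlMr ?ltr0n ?expn_gt0 //.
by rewrite lerBrDl -natrM -natrD ler_nat mulnC addnC addnC.
Qed.

(** A unit of norm in a coordinate past [j] costs weight at least [2 ^ j.+1], and only
    [N - weight u j.+1] is left to spend. *)
Lemma tail_le u v N j n : grid_seq u -> grid_seq v -> (total_weight v <= N)%N ->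
  (forall i, (i <= j)%N -> v i = u i) ->
  \sum_(j.+1 <= i < n) `|v i| <= (N - weight u j.+1)%:R / (2 ^ j.+1)%:R.
Proof.
move=> gu gv vN vu; have [nj|jn] := leqP n j.+1.
  by rewrite big_geq // divr_ge0.
rewrite ler_pdivlMr ?ltr0n ?expn_gt0 // mulr_suml.
apply: (@le_trans _ _ (\sum_(j.+1 <= i < n) (2 ^ i * layer (v i))%:R)).
  rewrite !big_nat; apply: ler_sum => i /andP[ji _].
  by rewrite (B_layer (gv.1 i)) -natrM ler_nat mulnC leq_mul2r leq_exp2l // ji orbT.
rewrite -natr_sum ler_nat.
have -> : weight u j.+1 = weight v j.+1 by apply: eq_weight => i ij; rewrite vu.
apply: leq_trans (leq_sub2r _ vN).
apply: leq_trans (leq_sub2r _ (weight_le_total n gv.2)).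
suff -> : weight v n =
    (weight v j.+1 + \sum_(j.+1 <= i < n) 2 ^ i * layer (v i))%N by rewrite addKn.
rewrite /weight -!(big_mkord xpredT (fun i => 2 ^ i * layer (v i))%N).
by rewrite -big_cat_nat // ltnW.
Qed.

(** The estimates hold at every [j] reached within the budget, so that two sequences can be compared
    at a common index. The natural subtraction makes the tail vanish once coordinate [j] overflows.
    In [beta + 1], the [1] pays for rounding to a layer and [beta] for parents that are not exactly
    radial. *)
Definition truncated N u v :=
  [/\ grid_seq v, (total_weight u <= N)%N -> v = u
    & forall j, (weight u j <= N)%N ->
        [/\ forall i, (i < j)%N -> v i = u i,
            `|v j - clip (budget N u j) (u j)| <= beta + 1
          & forall n, \sum_(j.+1 <= i < n) `|v i|
              <= (N - weight u j.+1)%:R / (2 ^ j.+1)%:R]].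

Lemma beta_ge0 : 0 <= beta.
Proof. by have [_ _] := q_trunc (B0 0) (leq0n _); exact: le_trans. Qed.

Lemma dist_parent_le u n : grid_seq u -> (forall i, (n <= i)%N -> u i = 0) ->
  `|\sum_(0 <= i < n) (u i - parent u i)| <= beta + 1.
Proof.
move=> gu un; have b0 := beta_ge0; have [->|[j [uj uj0 uE]]] := grid_seqE gu.
  rewrite parent0 big1 => [|i _]; last by rewrite subrr.
  by rewrite normr0 addr_ge0.
have jn : (j < n)%N.
  by rewrite ltnNge; apply: contra uj0 => /un ->.
rewrite big_mkord (bigD1 (Ordinal jn)) //= big1 => [|i ij].
  have l0 := layer_gt0 (gu.1 j) uj0; have [_ _ near] := q_trunc (gu.1 j) l0.
  rewrite addr0 (parentE uj) cutj /=; set x := u j in near uj0 *.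
  have x0 : 0 < `|x| by rewrite normr_gt0.
  have -> : x - q j x = `|x|^-1 *: x - (q j x - ((`|x| - 1) / `|x|) *: x).
    by rewrite mulrBl divff ?gt_eqF // mul1r scalerBl scale1r opprB addrA subrKC.
  apply: le_trans (ler_normB _ _) _; rewrite addrC lerD //.
  by rewrite normrZ normfV normr_id mulVf ?gt_eqF.
rewrite (parentE uj); move: ij; rewrite -val_eqE /= => ij.
have [lt|gt|e] := ltngtP i j; last by rewrite e eqxx in ij.
  by rewrite cutl // subrr.
by rewrite cutr // uE cutr // subrr.
Qed.

Lemma grid_seq_iter u k : grid_seq u -> grid_seq (iter k parent u).
Proof. by move=> gu; elim: k => //= k; exact: grid_seq_parent. Qed.

(** The step that brings the weight down to [N] acts on the coordinate [m] with
    [weight u m <= N < weight u m.+1]: earlier coordinates are intact and later ones are already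
    [0]. *)
Lemma truncated_iter N u k : grid_seq u -> (total_weight (iter k parent u) <= N)%N ->
  (forall i, (i < k)%N -> (N < total_weight (iter i parent u))%N) ->
  truncated N u (iter k parent u).
Proof.
move=> gu; have b0 := beta_ge0; case: k => [|k] vN kN.
  split=> // j _; rewrite clip_budget_id //; last first.
    exact: leq_trans (weight_le_total _ gu.2) vN.
  by split=> // [|n]; [rewrite /= subrr normr0 addr_ge0|exact: tail_le].
have := kN k (ltnSn k); have [->|[m [l [lm vE]]]] := iter_parent k gu.
  by rewrite (@total_weightE _ 0%N) // /weight big_ord0.
rewrite vE total_weight_cut ?(ltnW lm) // => Nlt.
have gv := grid_seq_iter k.+1 gu; rewrite iterS vE parent_cut // in vN gv *.
have vN' := vN; rewrite total_weight_cut // in vN'.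
have le_m : (weight u m <= N)%N by apply: leq_trans vN'; exact: leq_addr.
have lt_m : (N < weight u m.+1)%N.
  by apply: leq_trans Nlt _; rewrite weight_recr leq_add2l leq_mul2l leq_subr orbT.
split=> // [uN|j jN].
  by have := weight_le_total m.+1 gu.2; rewrite leqNgt (leq_ltn_trans uN).
have : (j <= m)%N.
  by rewrite leqNgt; apply/negP => /(leq_weight u); rewrite leqNgt (leq_ltn_trans jN).
rewrite leq_eqVlt => /predU1P[->|jm]; last first.
  rewrite clip_budget_id //; last by apply: leq_trans le_m; exact: leq_weight.
  split=> [i ij||n].
  - by rewrite cutl // (ltn_trans ij).
  - by rewrite cutl // subrr normr0 addr_ge0.
  - by apply: tail_le => // i ij; rewrite cutl // (leq_ltn_trans ij).
split=> [i im||n]; first by rewrite cutl.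
  rewrite cutj; have [_ _ near] := q_trunc (gu.1 m) lm.
  have pm : 0 < (2 ^ m)%:R :> R by rewrite ltr0n expn_gt0.
  set x := u m in lm near vN' Nlt *.
  have xE : `|x| = (layer x)%:R := B_layer (gu.1 m).
  have x0 : 0 < `|x| by rewrite xE ltr0n; apply: leq_ltn_trans lm.
  set t := budget N u m.
  (* The clipping radius lies between the norms of the [m]-th coordinates of two consecutive
     ancestors, so rounding costs at most [1]. *)
  have t_lt : t < `|x| - l%:R.
    rewrite xE -natrB ?(ltnW lm) // /t /budget ltr_pdivrMr //.
    by rewrite ltrBlDl -natrM -natrD ltr_nat mulnC.
  have t_ge : `|x| - l.+1%:R <= t.
    rewrite xE -natrB // /t /budget ler_pdivlMr //.
    by rewrite lerBrDl -natrM -natrD ler_nat mulnC.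
  have -> : clip t x = (t / `|x|) *: x.
    rewrite /clip ifF //; apply/negbTE; rewrite -ltNge; apply: lt_le_trans t_lt _.
    by rewrite gerBl.
  have -> : iter l.+1 (q m) x - (t / `|x|) *: x =
      (iter l.+1 (q m) x - ((`|x| - l.+1%:R) / `|x|) *: x)
      + ((`|x| - l.+1%:R - t) / `|x|) *: x.
    by rewrite [(_ - t) / _]mulrBl scalerBl addrA subrK.
  apply: le_trans (ler_normD _ _) (lerD near _).
  rewrite normrZ normrM normfV normr_id divfK ?gt_eqF //.
  rewrite ler0_norm ?subr_le0 //; rewrite -natr1 in t_ge *; lra.
rewrite big_nat big1 ?divr_ge0 // => i /andP[mi _].
by rewrite cutr // normr0.
Qed.

(** The factors [2 ^ i] with [i < n] sum to less than [2 ^ n]; after division by [2 ^ n] the bound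
    no longer depends on [n], which is what the geometric weights are for. *)
Lemma weight_dist u w (E : R) n : grid_seq u -> grid_seq w ->
  (forall i, `|u i - w i| <= E) ->
  `|(weight u n)%:R - (weight w n)%:R| <= (2 ^ n)%:R * E.
Proof.
move=> gu gw uw; have E0 : 0 <= E by apply: le_trans (uw 0%N).
elim: n => [|n IH]; first by rewrite /weight !big_ord0 subrr normr0 mul1r.
rewrite !weight_recr !natrD !natrM -(B_layer (gu.1 n)) -(B_layer (gw.1 n)).
rewrite opprD addrACA -mulrBr expnS natrM -mulrA [2 * _]mulr_natl mulr2n.
apply: le_trans (ler_normD _ _) (lerD IH _).
rewrite normrM normr_nat ler_wpM2l //.
exact: le_trans (ler_dist_dist _ _) (uw n).
Qed.

(** Compare at the first [j] where one of the two sequences overflows. The coordinates before [j]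
    contribute [E], the clipped one [6 * E + 2 * (beta + 1)], and each tail [2 * E]. *)
Lemma truncated_coarse_lipschitz N u w v z (E : R) :
  grid_seq u -> grid_seq w -> truncated N u v -> truncated N w z ->
  (forall n, `|\sum_(0 <= i < n) (u i - w i)| <= E) ->
  forall n, `|\sum_(0 <= i < n) (v i - z i)| <= 11 * E + 2 * (beta + 1).
Proof.
move=> gu gw [gv uv tv] [gz wz tz] uw n; have b0 := beta_ge0.
have E0 : 0 <= E by apply: le_trans (uw 0%N).
have uwi i : `|u i - w i| <= 2 * E.
  have -> : u i - w i =
      \sum_(0 <= i < i.+1) (u i - w i) - \sum_(0 <= i < i) (u i - w i).
    by rewrite big_nat_recr //= addrAC subrr add0r.
  by apply: le_trans (ler_normB _ _) _; rewrite mulr_natl mulr2n lerD.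
have wd m : `|(weight u m)%:R - (weight w m)%:R| / (2 ^ m)%:R <= 2 * E.
  by rewrite ler_pdivrMr ?ltr0n ?expn_gt0 // mulrC; exact: weight_dist.
have [le_all|] := pselect ((total_weight u <= N)%N /\ (total_weight w <= N)%N).
  rewrite (uv le_all.1) (wz le_all.2); apply: le_trans (uw n) _; lra.
move=> not_all.
have ex_j : exists j, ((N < weight u j.+1) || (N < weight w j.+1))%N.
  have over x : (N < total_weight x)%N -> exists j, (N < weight x j.+1)%N.
    rewrite /total_weight; case: (supp_len x) => [|j]; last by exists j.
    by rewrite /weight big_ord0.
  have [uN|/over[j jP]] := leqP (total_weight u) N; last by exists j; rewrite jP.
  have [wN|/over[j jP]] := leqP (total_weight w) N; first by case: not_all.
  by exists j; rewrite jP orbT.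
case: (ex_minnP ex_j) => j jP min_j.
have [uj wj] : (weight u j <= N)%N /\ (weight w j <= N)%N.
  case: j jP min_j => [|j] _ min_j; first by rewrite /weight !big_ord0.
  by split; rewrite leqNgt; apply/negP => lt; have := min_j j;
     rewrite lt ?orbT ltnn => /(_ isT).
have [vl vj vr] := tv j uj; have [zl zj zr] := tz j wj.
have head m : (m <= j)%N -> `|\sum_(0 <= i < m) (v i - z i)| <= E.
  move=> mj; apply: le_trans (uw m); rewrite !big_nat.
  rewrite (eq_bigr (fun i => u i - w i)) // => i /andP[_ im].
  by rewrite vl ?zl // (leq_trans im).
have [nj|jn] := leqP n j; first by apply: le_trans (head n nj) _; lra.
rewrite (@big_cat_nat _ _ _ j) //=; last exact: ltnW.
rewrite (big_ltn jn) [X in _ + (_ + X)]sumrB.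
have mid : `|v j - z j| <= 2 * (beta + 1) + 6 * E.
  have budget0 x : (weight x j <= N)%N -> 0 <= budget N x j.
    by move=> xN; rewrite divr_ge0 // subr_ge0 ler_nat.
  have := clip_lipschitz (u j) (w j) (budget0 w wj) (budget0 u uj).
  have -> : `|budget N u j - budget N w j| =
      `|(weight u j)%:R - (weight w j)%:R| / (2 ^ j)%:R.
    rewrite /budget -mulrBl normrM normfV normr_nat; congr (_ / _).
    by rewrite opprB addrC addrA subrK distrC.
  move=> cl; have -> : v j - z j = (v j - clip (budget N u j) (u j)) +
      ((clip (budget N u j) (u j) - clip (budget N w j) (w j)) -
       (z j - clip (budget N w j) (w j))).
    by rewrite opprB addrA subrKA addrA subrK.
  apply: le_trans (ler_normD _ _) _; apply: le_trans (lerD vj (ler_normB _ _)) _.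
  apply: le_trans (lerD (lexx _) (lerD cl zj)) _.
  have := wd j; have := uwi j; lra.
(* If [x] overflows, the natural subtraction gives [0]; if only [y] does, what is left to [x] is
   less than the difference of the weights. *)
have gap x y : ((N < weight x j.+1) || (N < weight y j.+1))%N ->
    (N - weight x j.+1)%:R <= `|(weight x j.+1)%:R - (weight y j.+1)%:R| :> R.
  have [xN|/ltnW xN _] := leqP (weight x j.+1) N; last by rewrite (eqP xN) normr_ge0.
  rewrite /= => yN; rewrite distrC natrB //; apply: le_trans (ler_norm _).
  by rewrite lerD2r ler_nat ltnW.
have tail_v : `|\sum_(j.+1 <= i < n) v i| <= 2 * E.
  apply: le_trans (ler_norm_sum _ _ _) _; apply: le_trans (vr n) _.
  apply: le_trans (wd j.+1); rewrite ler_pM2r ?invr_gt0 ?ltr0n ?expn_gt0 //.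
  exact: gap.
have tail_z : `|\sum_(j.+1 <= i < n) z i| <= 2 * E.
  apply: le_trans (ler_norm_sum _ _ _) _; apply: le_trans (zr n) _.
  apply: le_trans (wd j.+1); rewrite ler_pM2r ?invr_gt0 ?ltr0n ?expn_gt0 //.
  by rewrite distrC; apply: gap; rewrite orbC.
apply: le_trans (ler_normD _ _) _.
apply: le_trans (lerD (head j (leqnn j)) (ler_normD _ _)) _.
apply: le_trans (lerD (lexx _) (lerD mid (ler_normB _ _))) _.
lra.
Qed.

End WeightedTruncation.

(** * Spiderweb grids *)

Lemma minkowski_sumP (R : realType) (V : normedModType R) (B : nat -> set V) n x :
  (\big[@minkowski_add R V/[set 0]]_(m < n) B m) x <->
  exists2 u : nat -> V, (forall m, (m < n)%N -> B m (u m)) & x = \sum_(m < n) u m.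
Proof.
elim: n B x => [|n IH] B x.
  rewrite big_ord0; split=> [->|[u _ ->]]; last by rewrite big_ord0.
  by exists (fun=> 0); rewrite ?big_ord0.
rewrite big_ord_recl; split.
  move=> [y By] [z /(IH (fun m => B m.+1))[u Bu ->] <-].
  exists (fun m => if m is m'.+1 then u m' else y) => [[|m] //|]; first exact: Bu.
  by rewrite big_ord_recl.
move=> [u Bu ->]; rewrite big_ord_recl /=.
exists (u 0%N); first exact: Bu.
exists (\sum_(m < n) u m.+1) => //; apply/(IH (fun m => B m.+1)).
by exists (fun m => u m.+1) => // m; exact: Bu m.+1.
Qed.

Lemma series_finsupp (R : realType) (V : normedModType R) (u : nat -> V) n :
  (forall i, (n <= i)%N -> u i = 0) -> series u @ \oo --> \sum_(0 <= i < n) u i.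
Proof.
move=> un; apply/cvgrPdist_lt => e e0; exists n => // m /= nm.
have tail0 : \sum_(n <= i < m) u i = 0.
  by rewrite big_nat big1 // => i /andP[/un].
have -> : series u m = \sum_(0 <= i < n) u i.
  by rewrite /series /= (@big_cat_nat _ _ _ n) //= tail0 addr0.
by rewrite subrr normr0.
Qed.

Section Grid.
Context (R : realType) (X : completeNormedModType R) (Xs : nat -> set X).
Context (a b : R) (S : set X) (B : nat -> set X) (dec : X -> nat -> X).
Context (q : nat -> X -> X).
Hypothesis fdd : is_FDD Xs.
Hypothesis a_gt0 : 0 < a.
Hypothesis b_gt0 : 0 < b.
Hypothesis webs : forall m, spiderweb_base a b (Xs m) (B m).
Hypothesis SE : S = \bigcup_n \big[@minkowski_add R X/[set 0]]_(m < n.+1) B m.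
Hypothesis decX : forall x n, Xs n (dec x n).
Hypothesis decS : forall x, series (dec x) @ \oo --> x.
Hypothesis dec_uniq : forall x u,
  (forall n, Xs n (u n)) -> series u @ \oo --> x -> dec x = u.
Hypothesis qP : forall i x k, B i x -> (k <= layer x)%N ->
  [/\ B i (iter k (q i) x), `|iter k (q i) x| = `|x| - k%:R
    & `|iter k (q i) x - ((`|x| - k%:R) / `|x|) *: x| <= 4 * b].

Let subX n : is_subspace (Xs n).
Proof. by apply: finite_dim_subspaceP; exact: (fdd.1 n).1. Qed.

Let BX i x : B i x -> Xs i x.
Proof. by move=> /(spiderweb_mem (subX i) (webs i))[]. Qed.

Let B_layer i x : B i x -> `|x| = (layer x)%:R.
Proof. by move=> /(spiderweb_mem (subX i) (webs i))[]. Qed.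

Let B0 i : B i 0.
Proof. exact: spiderweb0 (webs i). Qed.

Lemma coordinates_sum u n : (forall i, Xs i (u i)) ->
  (forall i, (n <= i)%N -> u i = 0) -> dec (\sum_(0 <= i < n) u i) = u.
Proof. by move=> Xu un; apply: dec_uniq => //; exact: series_finsupp. Qed.

Lemma sum_coordinates x n : (forall i, (n <= i)%N -> dec x i = 0) ->
  x = \sum_(0 <= i < n) dec x i.
Proof.
by move=> xn; apply: (norm_cvg_unique (@decS x)); exact: series_finsupp.
Qed.

(** Each web contains [0], so a finite sum can be padded with zeros, and uniqueness of the expansion
    identifies its terms with the coordinates. *)
Lemma grid_memP x : S x <-> grid_seq B (dec x).
Proof.
rewrite SE; split=> [[n _ /minkowski_sumP[u Bu ->]]|[Bx [n xn]]].
  pose v i := if (i < n.+1)%N then u i else 0.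
  have Bv i : B i (v i) by rewrite /v; case: ifP => // /Bu.
  have v0 i : (n.+1 <= i)%N -> v i = 0 by move=> ni; rewrite /v ltnS leqNgt ni.
  have -> : \sum_(m < n.+1) u m = \sum_(0 <= i < n.+1) v i.
    by rewrite big_mkord; apply: eq_bigr => i _; rewrite /v ltn_ord.
  rewrite (coordinates_sum _ v0); last by move=> i; exact: BX.
  by split=> //; exists n.+1.
exists n => //; apply/minkowski_sumP; exists (dec x) => //.
rewrite -(big_mkord xpredT (dec x)); apply: sum_coordinates => i /ltnW; exact: xn.
Qed.

Let M := metric_subspace S.
Let c (x : M) : nat -> X := dec (set_val x).

Let c_grid x : grid_seq B (c x).
Proof. by apply/grid_memP; exact: set_valP. Qed.

Lemma grid_point u : grid_seq B u -> exists x : M, c x = u.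
Proof.
move=> [Bu [n un]]; have du := coordinates_sum (fun i => BX (Bu i)) un.
have Sx : S (\sum_(0 <= i < n) u i).
  by apply/grid_memP; rewrite du; split=> //; exists n.
pose x : M := exist _ (\sum_(0 <= i < n) u i) (mem_set Sx).
by exists x.
Qed.

Lemma coordinates_inj x y : c x = c y -> x = y.
Proof.
move=> cxy; apply: val_inj; apply: (norm_cvg_unique (@decS (val x))).
by rewrite -[dec _]/(c x) cxy; exact: decS.
Qed.

Lemma norm_sub_coordinates x y n :
  (forall i, (n <= i)%N -> c x i = 0) -> (forall i, (n <= i)%N -> c y i = 0) ->
  mdist x y = `|\sum_(0 <= i < n) (c x i - c y i)|.
Proof. by move=> /sum_coordinates xE /sum_coordinates yE; rewrite sumrB -xE -yE. Qed.

(** Weight at most [N] bounds every layer by [N] and kills the coordinates from index [N] on,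
    because [i < 2 ^ i]; each remaining coordinate has finitely many values. *)
Lemma finite_weight N : finite_set [set x : M | (total_weight (c x) <= N)%N].
Proof.
pose E k := [set \sum_(0 <= i < k) u i | u in
  [set u : nat -> X | forall i, B i (u i) /\ (layer (u i) <= N)%N]].
have finE k : finite_set (E k).
  elim: k => [|k IH].
    apply: (@sub_finite_set _ _ [set 0]); last exact: finite_set1.
    by move=> _ [u _ <-]; rewrite big_geq.
  apply: (@sub_finite_set _ _ [set x + y | x in E k & y in
      [set y | B k y /\ (layer y <= N)%N]]).
    move=> _ [u uP <-]; rewrite big_nat_recr //=.
    by exists (\sum_(0 <= i < k) u i); [exists u|exists (u k)].
  apply: finite_image2 => //.
  apply: (@finite_separated_bounded R X (Xs k) _ N%:R (Num.min a 1)).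
  - exact: (fdd.1 k).1.
  - by rewrite lt_min a_gt0 ltr01.
  - move=> y [By yN]; split; first exact: BX.
    by rewrite (B_layer By) ler_nat.
  by move=> y z [By _] [Bz _]; exact: (spiderweb_separated (subX k) (webs k)).
apply: (finite_preimage_inj (f := set_val) (finE N)) => [x xN|x y _ _ /val_inj //].
have layer_le i : (2 ^ i * layer (c x i) <= N)%N.
  apply: leq_trans xN; apply: leq_trans (weight_le_total i.+1 (c_grid x).2).
  by rewrite weight_recr leq_addl.
exists (c x) => [i|].
  split; first exact: (c_grid x).1.
  by apply: leq_trans (layer_le i); rewrite leq_pmull // expn_gt0.
apply/esym/sum_coordinates => i Ni; apply/eqP.
rewrite -normr_eq0 -/(c x i) (B_layer ((c_grid x).1 i)) pnatr_eq0.
have := leq_ltn_trans (leq_trans (layer_le i) Ni) (ltn_expl i (isT : (1 < 2)%N)).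
by case: (layer _) => // m; rewrite mulnS ltnNge leq_addr.
Qed.

Theorem retractional_basis_grid : has_retractional_basis M.
Proof.
have [D D0 DP] := fdd_constant fdd decX (@decS) (@dec_uniq).
have beta0 : 0 <= 4 * b by rewrite mulr_ge0 // ltW.
have /choice[p pP] : forall x : M, exists y : M, c y = parent q (c x).
  move=> x; apply: grid_point; exact: (grid_seq_parent B_layer B0 qP).
have c_iter k x : c (iter k p x) = iter k (parent q) (c x).
  by elim: k => //= k <-; rewrite pP.
have zero_seq : grid_seq B (fun=> 0) by split=> //; exists 0%N.
have [z0 cz0] := grid_point zero_seq.
have dist_sum x y n : `|\sum_(0 <= i < n) (c x i - c y i)| <= D * mdist x y.
  have := DP (set_val x - set_val y) n.
  by rewrite (partial_sumB fdd decX (@decS) (@dec_uniq)) /partial_sum /series /=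
     -sumrB.
have W_root : total_weight (c z0) = 0%N.
  by rewrite cz0 (@total_weightE _ _ _ 0%N) // /weight big_ord0.
have W_parent x : x <> z0 -> (total_weight (c (p x)) < total_weight (c x))%N.
  move=> xo; rewrite pP; apply: (total_weight_parent B_layer qP) => //.
  by rewrite -cz0 => /coordinates_inj.
have common x y : exists n, (forall i, (n <= i)%N -> c x i = 0) /\
    (forall i, (n <= i)%N -> c y i = 0).
  have [_ [m xm]] := c_grid x; have [_ [n yn]] := c_grid y.
  exists (maxn m n); split=> i; rewrite geq_max => /andP[mi ni].
    exact: xm.
  exact: yn.
have sep0 : 0 < Num.min a 1 by rewrite lt_min a_gt0 ltr01.
have D1 : 0 < 2 * D + 1 by rewrite ltr_wpDl // mulr_ge0.
(* Distinct points differ by at least [Num.min a 1] in some coordinate, and a coordinate difference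
   is at most [2 * D] times the distance; the [+ 1] guards against [D = 0]. The factor [11 * D] is
   [11 * E] with [E] equal to [D] times the distance. *)
apply: (@retractional_basis_of_tree R M p (fun x => total_weight (c x)) z0
  (Num.min a 1 / (2 * D + 1)) (11 * D) (2 * (4 * b + 1)) (4 * b + 1)) => //.
- exact: finite_weight.
- by rewrite divr_gt0.
- move=> x y xy; rewrite ler_pdivrMr //.
  have [i /eqP ci] : exists i, c x i <> c y i.
    by apply/existsNP => ce; apply/xy/coordinates_inj/funext.
  have := spiderweb_separated (subX i) (webs i)
    ((c_grid x).1 i) ((c_grid y).1 i) (elimN eqP ci).
  move=> /le_trans; apply.
  have -> : c x i - c y i = \sum_(0 <= k < i.+1) (c x k - c y k)
      - \sum_(0 <= k < i) (c x k - c y k).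
    by rewrite big_nat_recr //= addrAC subrr add0r.
  apply: le_trans (ler_normB _ _) _.
  apply: le_trans (lerD (dist_sum _ _ _) (dist_sum _ _ _)) _.
  have := mdist_ge0 x y; lra.
- move=> x _; have [n [xn pn]] := common x (p x).
  rewrite (norm_sub_coordinates xn pn) pP.
  exact: (dist_parent_le B_layer B0 qP).
move=> N x y; set A := [set _ | _].
have anc_trunc z : truncated B (4 * b) N (c z) (c (anc p A z)).
  have Az0 : A z0 by rewrite /A /= W_root.
  have [Az min_z] := ancP (reaches_root W_parent z Az0).
  have Wz := Az; rewrite /anc /A /= c_iter in Wz.
  rewrite /anc c_iter; apply: (truncated_iter B_layer B0 qP) => // i /min_z /negP.
  by rewrite /A /= c_iter -ltnNge.
have [n [xn yn]] := common (anc p A x) (anc p A y).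
rewrite (norm_sub_coordinates xn yn).
have := truncated_coarse_lipschitz B_layer B0 qP (c_grid x) (c_grid y)
  (anc_trunc x) (anc_trunc y) (dist_sum x y) n.
by rewrite mulrA.
Qed.

End Grid.

Theorem theorem3p9 (R : realType) (X : completeNormedModType R)
    (Xs : nat -> set X) (a b : R) (S : set X) :
  is_FDD Xs -> 0 < a -> 0 < b -> spiderweb_grid a b Xs S ->
  has_retractional_basis (metric_subspace S).
Proof.
move=> fdd a0 b0 [B [webs SE]].
have [dec [decX decS dec_uniq]] := fdd_coordinates fdd.
have subX n : is_subspace (Xs n).
  by apply: finite_dim_subspaceP; exact: (fdd.1 n).1.
have /choice[q qP] := fun i => spiderweb_truncation (subX i) (webs i) b0.
exact: (retractional_basis_grid fdd a0 b0 webs SE decX decS dec_uniq qP).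
Qed.
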